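(* Let $\mathfrak A$ be a self-induced Banach algebra and let $n\ge1$. Let $\iota_0:\mathfrak A\to M_n(\mathfrak A)$ be the map sending $a$ to the matrix with $a$ in position $(1,1)$ and $0$ elsewhere, let $\iota:\mathfrak A\widehat\otimes\mathfrak A\to M_n(\mathfrak A)\widehat\otimes M_n(\mathfrak A)$ be the map $\iota(a\otimes b)=\iota_0(a)\otimes\iota_0(b)$, and let $\tau:M_n(\mathfrak A)\widehat\otimes M_n(\mathfrak A)\to\mathfrak A\widehat\otimes\mathfrak A$ be the map $$\tau\big((a_{ij})\otimes(b_{ij})\big)=\sum_{i,j}a_{ij}\otimes b_{ji}.$$ Then the implemented maps $\iota^*:\mathcal H^1(M_n(\mathfrak A),M_n(\mathfrak A)^* )\to\mathcal H^1(\mathfrak A,\mathfrak A^* )$ and $\tau^*:\mathcal H^1(\mathfrak A,\mathfrak A^* )\to\mathcal H^1(M_n(\mathfrak A),M_n(\mathfrak A)^* )$ are inverses of one another.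
   Context: All Banach spaces are complex and all linear maps are bounded. $\widehat\otimes$ is the projective tensor product; for a right Banach $\mathfrak A$-module $P$ and a left Banach $\mathfrak A$-module $Q$, $P\widehat\otimes_{\mathfrak A}Q$ is the quotient of $P\widehat\otimes Q$ by the closed linear span of $\{pa\otimes q-p\otimes aq\}$. A Banach algebra $\mathfrak A$ is self-induced if the map $\mathfrak A\widehat\otimes_{\mathfrak A}\mathfrak A\to\mathfrak A$ implemented by multiplication is a (topological) isomorphism. $M_n(\mathfrak A)$ is the Banach algebra of $n\times n$ matrices over $\mathfrak A$. $\mathcal H^1(\mathfrak A,\mathfrak A^* )$ is the first bounded Hochschild cohomology group: bounded derivations $D:\mathfrak A\to\mathfrak A^*$ modulo inner derivations, where $\mathfrak A^*$ has the bimodule structure $\langle x,a\cdot f\rangle=\langle xa,f\rangle$, $\langle x,f\cdot a\rangle=\langle ax,f\rangle$. A bounded linear map $D:\mathfrak A\to\mathfrak A^*$ is identified with the functional $a\otimes b\mapsto\langle a,D(b)\rangle$ on $\mathfrak A\widehat\otimes\mathfrak A$ (and similarly for $M_n(\mathfrak A)$), and the maps implemented by $\iota$ and $\tau$ are obtained by composing these functionals with $\iota$ and $\tau$: thus $\langle a,(\iota^*D)(b)\rangle=\langle\iota_0(a),D(\iota_0(b))\rangle$ and $\langle(a_{ij}),(\tau^*D)((b_{ij}))\rangle=\sum_{i,j}\langle a_{ij},D(b_{ji})\rangle$. *)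

(* Defs.v *)
From HB Require Import structures.
From mathcomp Require Import all_boot all_order all_algebra.
From mathcomp Require Import generic_quotient ring_quotient complex.
From mathcomp Require Import mathcomp_extra boolp classical_sets functions.
From mathcomp Require Import reals topology normedtype sequences.
From mathcomp Require Import ring lra.
Set Implicit Arguments.
Unset Strict Implicit.
Unset Printing Implicit Defensive.
Import Order.TTheory GRing.Theory Num.Theory.
Import numFieldNormedType.Exports.
Local Open Scope classical_set_scope.
Local Open Scope ring_scope.
Local Open Scope complex_scope.
Local Open Scope quotient_scope.

(* The norm of a complex normed module takes its values in [R[i]]; [nrm] is the
   same norm with values in [R]. *)
Definition nrm (R : realType) (E : normedModType R[i]) (x : E) : R :=
  complex.Re `|x|.

Section NrmTheory.
Context {R : realType} {E : normedModType R[i]}.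
Implicit Types (x y : E).

Lemma nrmE x : `|x| = (nrm x)%:C.
Proof. by rewrite /nrm RRe_real // ger0_real. Qed.

Lemma nrm_ge0 x : 0 <= nrm x.
Proof. by rewrite -ler0c -nrmE. Qed.

Lemma nrm0 : nrm (0 : E) = 0.
Proof. by rewrite /nrm normr0. Qed.

Lemma nrm_eq0 x : nrm x = 0 -> x = 0.
Proof. by move=> h; apply/normr0_eq0; rewrite nrmE h. Qed.

Lemma nrmD x y : nrm (x + y) <= nrm x + nrm y.
Proof. by rewrite -lecR rmorphD /= -!nrmE ler_normD. Qed.

Lemma nrmN x : nrm (- x) = nrm x.
Proof. by rewrite /nrm normrN. Qed.

Lemma nrmB x y : nrm (x - y) = nrm (y - x).
Proof. by rewrite -nrmN opprB. Qed.

Lemma nrmZ (c : R[i]) x : nrm (c *: x) = complex.Re `|c| * nrm x.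
Proof.
by apply: complexI; rewrite rmorphM /= -!nrmE normrZ; congr (_ * _).
Qed.

Lemma nrm_triangle x y z : nrm (x - z) <= nrm (x - y) + nrm (y - z).
Proof. by rewrite -[x - z](subrKA y) nrmD. Qed.

Lemma nrm_sum (I : Type) (s : seq I) (P : pred I) (F : I -> E) :
  nrm (\sum_(i <- s | P i) F i) <= \sum_(i <- s | P i) nrm (F i).
Proof.
elim/big_rec2: _ => [|i b x _ h]; first by rewrite nrm0.
by rewrite (le_trans (nrmD _ _)) // lerD2l.
Qed.

End NrmTheory.

Lemma nrm_scalar (R : realType) (c : (R[i])^o) : nrm c = complex.Re `|c : R[i]|.
Proof. by []. Qed.

Lemma Re_norm_ge0 (R : realType) (c : R[i]) : 0 <= complex.Re `|c|.
Proof. exact: (@nrm_ge0 R (R[i])^o c). Qed.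

Lemma Re_normE (R : realType) (c : R[i]) : (complex.Re `|c|)%:C = `|c|.
Proof. by rewrite RRe_real // ger0_real. Qed.

(* Cauchy and convergent sequences for a real-valued seminorm [p]. *)
Definition seq_cauchy (R : realType) (V : zmodType) (p : V -> R)
    (u : nat -> V) : Prop :=
  forall e : R, 0 < e ->
    exists N, forall m n, (N <= m)%N -> (N <= n)%N -> p (u m - u n) < e.

Definition seq_cvg (R : realType) (V : zmodType) (p : V -> R)
    (u : nat -> V) (l : V) : Prop :=
  forall e : R, 0 < e -> exists N, forall n, (N <= n)%N -> p (u n - l) < e.

Section Complete.
Context {R : realType}.

Lemma nrm_ballP (E : normedModType R[i]) (x y : E) (e : R) :
  ball x e%:C y <-> nrm (x - y) < e.
Proof. by rewrite -ball_normE /ball_ /= nrmE ltcR. Qed.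

Lemma gt0_complexP (e : R[i]) : 0 < e -> exists2 r : R, 0 < r & e = r%:C.
Proof.
move=> e0; exists (complex.Re e); last by rewrite RRe_real // gtr0_real.
by rewrite -ltcR RRe_real // gtr0_real.
Qed.

Lemma seq_cauchy_cvg (E : completeNormedModType R[i]) (u : nat -> E) :
  seq_cauchy (@nrm R E) u -> exists l, seq_cvg (@nrm R E) u l.
Proof.
move=> cu; have : cvg (u @ \oo).
  apply: cauchy_cvg; apply/cauchyP => e /gt0_complexP[r r0 ->].
  have [N hN] := cu _ r0.
  exists (u N); exists N => // n /= Nn; apply/nrm_ballP; exact: hN.
case/cvg_ex => l /cvgrPdist_lt ul; exists l => e e0.
have e0' : 0 < (e%:C : R[i]) by rewrite ltcR.
have [N _ hN] := ul _ e0'; exists N => n Nn.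
by rewrite nrmB -ltcR -nrmE; apply: hN.
Qed.

Lemma seq_complete (E : normedModType R[i]) :
  (forall u : nat -> E, seq_cauchy (@nrm R E) u ->
     exists l, seq_cvg (@nrm R E) u l) ->
  forall F : set_system E, ProperFilter F -> cauchy F -> cvg F.
Proof.
move=> sc F FF /cauchyP cF.
pose eps n : R := (n.+1%:R)^-1.
have eps0 n : 0 < eps n by rewrite invr_gt0 ltr0n.
have cex n : {x : E | F (ball x ((eps n)%:C))}.
  by apply/cid/cF; rewrite ltcR.
pose u n := sval (cex n).
have uF n : F (ball (u n) ((eps n)%:C)) by exact: svalP (cex n).
have umn m n : nrm (u m - u n) < eps m + eps n.
  have /filter_ex[x [xm xn]] :
    F (ball (u m) (eps m)%:C `&` ball (u n) (eps n)%:C).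
    by apply: filterI; exact: uF.
  rewrite (le_lt_trans (nrm_triangle _ x _)) // ltrD //.
    exact/nrm_ballP.
  by rewrite nrmB; exact/nrm_ballP.
have small e : 0 < e -> exists N, forall n, (N <= n)%N -> eps n < e.
  move=> e0; exists (Num.bound (e^-1)) => n hn.
  rewrite /eps -[e]invrK ltf_pV2 ?posrE ?ltr0n ?invr_gt0 //.
  have e1 : 0 <= e^-1 by rewrite invr_ge0 ltW.
  apply: (lt_le_trans (archi_boundP e1)).
  by rewrite ler_nat; exact: leq_trans hn (leqnSn _).
have [|l ul] := sc u.
  move=> e e0; have /small[N hN] : 0 < e / 2 by rewrite divr_gt0.
  exists N => m n hm hn; rewrite (lt_trans (umn _ _)) // [e]splitr.
  by rewrite ltrD // hN.
apply/cvg_ex; exists l; apply/cvgrPdist_lt => e /gt0_complexP[r r0 ->].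
have r2 : 0 < r / 2 by rewrite divr_gt0.
have [N1 h1] := ul _ r2; have [N2 h2] := small _ r2.
pose n := maxn N1 N2.
apply: filterS (uF n) => x /nrm_ballP xn.
rewrite nrmE ltcR (le_lt_trans (nrm_triangle _ (u n) _)) // [r]splitr.
rewrite ltrD //; first by rewrite nrmB h1 // leq_maxl.
by rewrite (lt_trans xn) // h2 // leq_maxr.
Qed.

Let C : normedModType R[i] := (R[i])^o.

Lemma Re_le_norm (x : R[i]) : `|complex.Re x| <= complex.Re `|x|.
Proof. by rewrite -lecR Re_normE normc_ge_Re. Qed.

Lemma Im_le_norm (x : R[i]) : `|complex.Im x| <= complex.Re `|x|.
Proof.
have := Re_le_norm (x * 'i%C); rewrite ReiNIm normrN normrM.
suff -> : `|'i%C : R[i]| = 1 by rewrite mulr1.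
by rewrite normc_def /= expr0n /= add0r expr1n sqrtr1.
Qed.

Lemma norm_le_ReIm (x : R[i]) :
  complex.Re `|x| <= `|complex.Re x| + `|complex.Im x|.
Proof.
rewrite normc_def /= -[leRHS]ger0_norm ?addr_ge0 // -sqrtr_sqr ler_wsqrtr //.
rewrite sqrrD !real_normK ?num_real //.
have := mulr_ge0 (normr_ge0 (complex.Re x)) (normr_ge0 (complex.Im x)).
lra.
Qed.

Lemma R_seq_cauchy (a : nat -> R) :
  (forall e : R, 0 < e ->
    exists N, forall m n, (N <= m)%N -> (N <= n)%N -> `|a m - a n| < e) ->
  exists l, forall e : R, 0 < e ->
    exists N, forall n, (N <= n)%N -> `|a n - l| < e.
Proof.
move=> ca; have : cvg (a @ \oo).
  apply: R_complete; apply/cauchyP => e e0; have [N hN] := ca _ e0.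
  by exists (a N); exists N => // n /= Nn; rewrite /ball /=; exact: hN.
case/cvg_ex => l /cvgrPdist_lt al; exists l => e e0.
have [N _ hN] := al _ e0; exists N => n Nn.
by rewrite distrC; apply: hN.
Qed.

Lemma complex_complete (F : set_system C) :
  ProperFilter F -> cauchy F -> cvg F.
Proof.
apply: seq_complete => u cu.
have [a ha] : exists l, forall e : R, 0 < e ->
    exists N, forall n, (N <= n)%N -> `|complex.Re (u n) - l| < e.
  apply: R_seq_cauchy => e /cu[N hN]; exists N => m n hm hn.
  by rewrite -raddfB (le_lt_trans (Re_le_norm _)) // hN.
have [b hb] : exists l, forall e : R, 0 < e ->
    exists N, forall n, (N <= n)%N -> `|complex.Im (u n) - l| < e.
  apply: R_seq_cauchy => e /cu[N hN]; exists N => m n hm hn.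
  by rewrite -raddfB (le_lt_trans (Im_le_norm _)) // hN.
exists (a +i* b) => e e0; have e2 : 0 < e / 2 by rewrite divr_gt0.
have [N1 h1] := ha _ e2; have [N2 h2] := hb _ e2.
exists (maxn N1 N2) => n; rewrite geq_max => /andP[n1 n2].
rewrite (le_lt_trans (norm_le_ReIm _)) // [e]splitr !raddfB /=.
by rewrite ltrD // ?h1 ?h2.
Qed.

End Complete.

(* The complex numbers as a Banach space over themselves. *)
Definition cplx (R : realType) : Type := (R[i])^o.

HB.instance Definition _ (R : realType) :=
  NormedModule.copy (cplx R) (R[i])^o.
HB.instance Definition _ (R : realType) :=
  Uniform_isComplete.Build (cplx R) (@complex_complete R).

Definition submod_pred (K : pzRingType) (V : lmodType K)
    (S : submodClosed V) : {pred V} := [pred x | x \in S].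

Fact submod_zmod_closed (K : pzRingType) (V : lmodType K)
  (S : submodClosed V) : zmod_closed (submod_pred S).
Proof.
split=> [|x y]; rewrite !inE; first exact: rpred0.
by move=> Sx Sy; rewrite rpredD // -scaleN1r rpredZ.
Qed.

HB.instance Definition _ (K : pzRingType) (V : lmodType K)
    (S : submodClosed V) :=
  GRing.isZmodClosed.Build V (submod_pred S) (submod_zmod_closed S).

Definition lquot (K : pzRingType) (V : lmodType K) (S : submodClosed V) : Type :=
  (Quotient.quot (submod_pred S)).

Section LquotTheory.
Context {K : pzRingType} {V : lmodType K} (S : submodClosed V).

HB.instance Definition _ := GRing.Zmodule.copy (lquot S) (Quotient.quot (submod_pred S)).

Definition lpi (x : V) : lquot S := \pi_(Quotient.quot (submod_pred S)) x.
Definition lrepr (q : lquot S) : V := repr (q : (Quotient.quot (submod_pred S))).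

Lemma lreprK q : lpi (lrepr q) = q.
Proof. exact: reprK. Qed.

Lemma lpi_eq x y : lpi x = lpi y <-> x - y \in S.
Proof.
have -> : x - y \in S = (x - y \in submod_pred S) by [].
by rewrite Quotient.idealrBE; split; [move=> /eqP|move/eqP].
Qed.

Lemma lpi0 : lpi 0 = 0.
Proof. exact: raddf0. Qed.

Lemma lpiD x y : lpi (x + y) = lpi x + lpi y.
Proof. exact: raddfD. Qed.

Lemma lpiN x : lpi (- x) = - lpi x.
Proof. exact: raddfN. Qed.

Lemma lpiB x y : lpi (x - y) = lpi x - lpi y.
Proof. by rewrite lpiD lpiN. Qed.

Lemma lpi_eq0 x : lpi x = 0 <-> x \in S.
Proof. by rewrite -lpi0 lpi_eq subr0. Qed.

Definition lquot_scale (c : K) (q : lquot S) : lquot S := lpi (c *: lrepr q).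

Lemma lquot_scaleE c x : lquot_scale c (lpi x) = lpi (c *: x).
Proof.
apply/lpi_eq; rewrite -scalerBr rpredZ //.
by apply/lpi_eq; rewrite lreprK.
Qed.

Fact lquot_scaleA a b v :
  lquot_scale a (lquot_scale b v) = lquot_scale (a * b) v.
Proof. by rewrite -[v]lreprK !lquot_scaleE scalerA. Qed.

Fact lquot_scale1 : left_id 1 lquot_scale.
Proof. by move=> v; rewrite -[v]lreprK lquot_scaleE scale1r. Qed.

Fact lquot_scaleDr : right_distributive lquot_scale +%R.
Proof.
move=> a u v; rewrite -[u]lreprK -[v]lreprK -lpiD !lquot_scaleE -lpiD.
by rewrite scalerDr.
Qed.

Fact lquot_scaleDl v : {morph lquot_scale^~ v : a b / a + b}.
Proof.
by move=> a b; rewrite -[v]lreprK !lquot_scaleE -lpiD scalerDl.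
Qed.

HB.instance Definition _ := GRing.Zmodule_isLmodule.Build K (lquot S)
  lquot_scaleA lquot_scale1 lquot_scaleDr lquot_scaleDl.

Lemma lpiZ c x : lpi (c *: x) = c *: lpi x.
Proof. by rewrite -lquot_scaleE. Qed.

End LquotTheory.

Definition bounded_linear (R : realType) (E F : normedModType R[i])
    (f : E -> F) : Prop :=
  linear f /\ exists M : R, forall x, nrm (f x) <= M * nrm x.

Definition bounded_linear_pred (R : realType) (E F : normedModType R[i]) :
  {pred E -> F} := [pred f | `[< bounded_linear f >]].

Record bmap (R : realType) (E F : normedModType R[i]) := BMap {
  bmap_fun :> E -> F;
  bmap_subproof : bmap_fun \in @bounded_linear_pred R E F }.

Section BmapTheory.
Context {R : realType} {E F : normedModType R[i]}.

HB.instance Definition _ := [isSub for @bmap_fun R E F].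
HB.instance Definition _ := [Choice of bmap E F by <:].

Lemma bounded_linear_submod : submod_closed (@bounded_linear_pred R E F).
Proof.
split=> [|a f g]; rewrite ?inE.
  split=> [c x y|]; first by rewrite [RHS](_ : _ = c *: 0 + 0) // scaler0 addr0.
  by exists 0 => x; rewrite nrm0 mul0r.
move=> [fl [M fM]] [gl [N gN]]; split=> [c x y|].
  rewrite !fctE fl gl !scalerDr !scalerA [a * c]mulrC.
  by rewrite addrACA.
exists (complex.Re `|a| * M + N) => x; rewrite !fctE.
rewrite (le_trans (nrmD _ _)) // nrmZ mulrDl lerD // -mulrA.
by rewrite ler_wpM2l ?Re_norm_ge0.
Qed.

HB.instance Definition _ :=
  GRing.isSubmodClosed.Build R[i] (E -> F)
    (@bounded_linear_pred R E F)
    bounded_linear_submod.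

HB.instance Definition _ := [SubChoice_isSubLmodule of bmap E F by <:].

Definition mkbmap (f : E -> F) (h : bounded_linear f) : bmap E F :=
  BMap (introT (asboolP _) h).

Implicit Types f g : bmap E F.

Lemma bmapP f : bounded_linear f.
Proof. by case: f => f fP; apply/(asboolP _). Qed.

Lemma bmap_linear f : linear f. Proof. by have [] := bmapP f. Qed.

Lemma bmap_ext f g : (forall x, f x = g x) -> f = g.
Proof. by move=> h; apply/val_inj/funext. Qed.

Lemma bmapDr f x y : f (x + y) = f x + f y.
Proof. by rewrite -[x]scale1r bmap_linear !scale1r. Qed.

Lemma bmap0r f : f 0 = 0.
Proof. by apply: (addrI (f 0)); rewrite -bmapDr !addr0. Qed.

Lemma bmapZr f c x : f (c *: x) = c *: f x.
Proof. by rewrite -[c *: x]addr0 bmap_linear bmap0r addr0. Qed.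

Lemma bmapNr f x : f (- x) = - f x.
Proof. by rewrite -scaleN1r bmapZr scaleN1r. Qed.

Lemma bmapBr f x y : f (x - y) = f x - f y.
Proof. by rewrite bmapDr bmapNr. Qed.

Lemma bmap_sumr f (I : Type) (s : seq I) (P : pred I) (G : I -> E) :
  f (\sum_(i <- s | P i) G i) = \sum_(i <- s | P i) f (G i).
Proof.
by elim/big_rec2: _ => [|i a b _ <-]; rewrite ?bmap0r // bmapDr.
Qed.

Lemma bmapDl f g x : (f + g) x = f x + g x. Proof. by []. Qed.
Lemma bmap0l x : (0 : bmap E F) x = 0. Proof. by []. Qed.
Lemma bmapNl f x : (- f) x = - f x. Proof. by []. Qed.
Lemma bmapBl f g x : (f - g) x = f x - g x. Proof. by []. Qed.
Lemma bmapZl c f x : (c *: f) x = c *: f x. Proof. by []. Qed.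

Lemma bmap_suml (I : Type) (s : seq I) (P : pred I) (f_ : I -> bmap E F) x :
  (\sum_(i <- s | P i) f_ i) x = \sum_(i <- s | P i) f_ i x.
Proof. by elim/big_rec2: _ => // i a b _ <-. Qed.

Definition opbounds f : set R :=
  [set M | 0 <= M /\ forall x, nrm (f x) <= M * nrm x].

Definition opnorm f : R := inf (opbounds f).

Lemma opbounds_inf f : has_inf (opbounds f).
Proof.
split; last by exists 0 => M [].
have [_ [M hM]] := bmapP f; exists `|M|; split=> // x.
by rewrite (le_trans (hM x)) // ler_wpM2r ?nrm_ge0 // ler_norm.
Qed.

Lemma opnorm_ge0 f : 0 <= opnorm f.
Proof. by apply: lb_le_inf => [|M []//]; case: (opbounds_inf f). Qed.

Lemma opnorm_le f M : 0 <= M -> (forall x, nrm (f x) <= M * nrm x) ->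
  opnorm f <= M.
Proof. by move=> M0 hM; apply: ge_inf; [case: (opbounds_inf f)|]. Qed.

Lemma opnormP f x : nrm (f x) <= opnorm f * nrm x.
Proof.
have := nrm_ge0 x; rewrite le_eqVlt => /predU1P[/esym x0|x0].
  by rewrite x0 mulr0 (nrm_eq0 x0) bmap0r nrm0.
rewrite -ler_pdivrMr //; apply: lb_le_inf.
  by case: (opbounds_inf f).
by move=> M [_ hM]; rewrite ler_pdivrMr.
Qed.

Fact opnormD f g : (opnorm (f + g))%:C <= (opnorm f)%:C + (opnorm g)%:C.
Proof.
rewrite -rmorphD lecR opnorm_le ?addr_ge0 ?opnorm_ge0 // => x.
by rewrite bmapDl (le_trans (nrmD _ _)) // mulrDl lerD // opnormP.
Qed.

Fact opnormZ (c : R[i]) f : (opnorm (c *: f))%:C = `|c| * (opnorm f)%:C.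
Proof.
suff le (d : R[i]) g : opnorm (d *: g) <= complex.Re `|d| * opnorm g.
  rewrite -Re_normE -rmorphM; congr (_%:C); apply/eqP; rewrite eq_le le andTb.
  have [->|c0] := eqVneq c 0.
    by rewrite normr0 mul0r opnorm_ge0.
  have := le c^-1 (c *: f); rewrite scalerA mulVf // scale1r.
  have -> : complex.Re `|c^-1| = (complex.Re `|c|)^-1.
    by apply: complexI; rewrite fmorphV !Re_normE normfV.
  by rewrite ler_pdivlMl // -ltcR Re_normE normr_gt0.
apply: opnorm_le => [|x]; first by rewrite mulr_ge0 ?Re_norm_ge0 ?opnorm_ge0.
by rewrite bmapZl nrmZ -mulrA ler_wpM2l ?Re_norm_ge0 // opnormP.
Qed.

Fact opnorm_eq0 f : (opnorm f)%:C = 0 -> f = 0.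
Proof.
move=> /complexI f0; apply: bmap_ext => x; apply: nrm_eq0.
by apply/eqP; rewrite eq_le nrm_ge0 andbT -(mul0r (nrm x)) -f0 opnormP.
Qed.

HB.instance Definition _ :=
  Lmodule_isNormed.Build R[i] (bmap E F) opnormD opnormZ opnorm_eq0.

Lemma nrm_bmapE f : nrm f = opnorm f.
Proof. by []. Qed.

End BmapTheory.

Definition dual (R : realType) (E : normedModType R[i]) : normedModType R[i] :=
  bmap E (cplx R).

(* The algebraic tensor product: formal sums of pairs, two of them being
   identified when every bilinear map gives them the same value. *)
Definition bilinear_map (K : pzRingType) (E F G : lmodType K)
    (b : E -> F -> G) : Prop :=
  (forall y, linear (b^~ y)) /\ (forall x, linear (b x)).

Definition fsum_eval (K : pzRingType) (E F G : lmodType K)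
    (b : E -> F -> G) (s : seq (E * F)) : G :=
  \sum_(p <- s) b p.1 p.2.

Section AlgTensor.
Context {K : comPzRingType}.
Variables E F : lmodType K.
Implicit Types (s : seq (E * F)).

Definition fsum_eq : rel (seq (E * F)) := fun s t =>
  `[< forall (G : lmodType K) (b : E -> F -> G), bilinear_map b ->
        fsum_eval b s = fsum_eval b t >].

Fact fsum_eq_equiv : equiv_class_of fsum_eq.
Proof.
split=> [s|s t|t s u]; first exact/asboolP.
  by apply/asboolP/asboolP => h G b hb; rewrite h.
by move=> /asboolP st /asboolP tu; apply/asboolP => G b hb; rewrite st ?tu.
Qed.

Canonical fsum_eq_equivRel := EquivRelPack fsum_eq_equiv.
Canonical fsum_eq_encModRel := defaultEncModRel fsum_eq.

Definition atensor : Type := {eq_quot fsum_eq}.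

HB.instance Definition _ := Choice.copy atensor {eq_quot fsum_eq}.

Definition api s : atensor := \pi_({eq_quot fsum_eq}) s.
Definition arepr (t : atensor) : seq (E * F) := repr (t : {eq_quot fsum_eq}).

Lemma areprK (t : atensor) : api (arepr t) = t.
Proof. exact: reprK. Qed.

Lemma api_eq s (t : seq (E * F)) : api s = api t <->
  forall (G : lmodType K) (b : E -> F -> G), bilinear_map b ->
        fsum_eval b s = fsum_eval b t.
Proof.
split=> [/eqmodP/asboolP //|h].
by apply/eqmodP/asboolP.
Qed.

Lemma arepr_eval s (G : lmodType K) (b : E -> F -> G) : bilinear_map b ->
  fsum_eval b (arepr (api s)) = fsum_eval b s.
Proof. by move: G b; apply/api_eq; rewrite areprK. Qed.

Definition fsum_scale (c : K) s := [seq (c *: p.1, p.2) | p <- s].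

Lemma bilin0l (G : lmodType K) (b : E -> F -> G) : bilinear_map b ->
  forall y, b 0 y = 0.
Proof.
move=> [bl _] y; have := bl y 1 0 0; rewrite !scale1r addr0.
by move/esym/(canRL (addrK _)); rewrite subrr.
Qed.

Lemma bilin0r (G : lmodType K) (b : E -> F -> G) : bilinear_map b ->
  forall x, b x 0 = 0.
Proof.
move=> [_ br] x; have := br x 1 0 0; rewrite !scale1r addr0.
by move/esym/(canRL (addrK _)); rewrite subrr.
Qed.

Lemma bilinZl (G : lmodType K) (b : E -> F -> G) : bilinear_map b ->
  forall c x y, b (c *: x) y = c *: b x y.
Proof.
by move=> hb c x y; have := hb.1 y c x 0; rewrite addr0 bilin0l // addr0.
Qed.

Lemma bilinZr (G : lmodType K) (b : E -> F -> G) : bilinear_map b ->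
  forall c x y, b x (c *: y) = c *: b x y.
Proof.
by move=> hb c x y; have := hb.2 x c y 0; rewrite addr0 bilin0r // addr0.
Qed.

Lemma bilinDl (G : lmodType K) (b : E -> F -> G) : bilinear_map b ->
  forall x x' y, b (x + x') y = b x y + b x' y.
Proof.
by move=> hb x x' y; have := hb.1 y 1 x x'; rewrite !scale1r.
Qed.

Lemma bilinDr (G : lmodType K) (b : E -> F -> G) : bilinear_map b ->
  forall x y y', b x (y + y') = b x y + b x y'.
Proof.
by move=> hb x y y'; have := hb.2 x 1 y y'; rewrite !scale1r.
Qed.

Lemma fsum_eval_cat (G : lmodType K) (b : E -> F -> G) s t :
  fsum_eval b (s ++ t) = fsum_eval b s + fsum_eval b t.
Proof. by rewrite /fsum_eval big_cat. Qed.

Lemma fsum_eval_scale (G : lmodType K) (b : E -> F -> G) :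
  bilinear_map b ->
  forall c s, fsum_eval b (fsum_scale c s) = c *: fsum_eval b s.
Proof.
move=> hb c s; rewrite /fsum_eval big_map scaler_sumr.
by apply: eq_bigr => p _; rewrite bilinZl.
Qed.

Definition atensor_zero : atensor := api [::].
Definition atensor_add (t u : atensor) : atensor := api (arepr t ++ arepr u).
Definition atensor_scale (c : K) (t : atensor) : atensor :=
  api (fsum_scale c (arepr t)).
Definition atensor_opp (t : atensor) : atensor := atensor_scale (-1) t.

Lemma atensor_addE s t : atensor_add (api s) (api t) = api (s ++ t).
Proof.
apply/api_eq => G b hb; rewrite !fsum_eval_cat.
by rewrite !arepr_eval.
Qed.

Lemma atensor_scaleE c s : atensor_scale c (api s) = api (fsum_scale c s).
Proof.
apply/api_eq => G b hb; rewrite !fsum_eval_scale //.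
by rewrite arepr_eval.
Qed.

Fact atensor_addA : associative atensor_add.
Proof.
by move=> t u v; rewrite -[t]areprK -[u]areprK -[v]areprK !atensor_addE catA.
Qed.

Fact atensor_addC : commutative atensor_add.
Proof.
move=> t u; rewrite -[t]areprK -[u]areprK !atensor_addE.
by apply/api_eq => G b hb; rewrite !fsum_eval_cat addrC.
Qed.

Fact atensor_add0 : left_id atensor_zero atensor_add.
Proof. by move=> t; rewrite -[t]areprK atensor_addE. Qed.

Fact atensor_addN : left_inverse atensor_zero atensor_opp atensor_add.
Proof.
move=> t; rewrite -[t]areprK /atensor_opp atensor_scaleE atensor_addE.
apply/api_eq => G b hb; rewrite fsum_eval_cat fsum_eval_scale // scaleN1r addNr.
by rewrite /fsum_eval big_nil.
Qed.

HB.instance Definition _ := GRing.isZmodule.Build atensor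
  atensor_addA atensor_addC atensor_add0 atensor_addN.

Fact atensor_scaleA a b v :
  atensor_scale a (atensor_scale b v) = atensor_scale (a * b) v.
Proof.
rewrite -[v]areprK !atensor_scaleE.
by apply/api_eq => G f hf; rewrite !fsum_eval_scale // scalerA.
Qed.

Fact atensor_scale1 : left_id 1 atensor_scale.
Proof.
move=> v; rewrite -[v]areprK !atensor_scaleE.
by apply/api_eq => G f hf; rewrite !fsum_eval_scale // scale1r.
Qed.

Fact atensor_scaleDr : right_distributive atensor_scale +%R.
Proof.
move=> a u v; rewrite -[u]areprK -[v]areprK.
rewrite [_ + _]atensor_addE !atensor_scaleE [RHS]atensor_addE.
by rewrite /fsum_scale map_cat.
Qed.

Fact atensor_scaleDl v : {morph atensor_scale^~ v : a b / a + b}.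
Proof.
move=> a b; rewrite -[v]areprK !atensor_scaleE [RHS]atensor_addE.
apply/api_eq => G f hf.
by rewrite fsum_eval_cat !fsum_eval_scale // scalerDl.
Qed.

HB.instance Definition _ := GRing.Zmodule_isLmodule.Build K atensor
  atensor_scaleA atensor_scale1 atensor_scaleDr atensor_scaleDl.

Lemma apiD s t : api s + api t = api (s ++ t).
Proof. exact: atensor_addE. Qed.

Lemma apiZ c s : c *: api s = api (fsum_scale c s).
Proof. exact: atensor_scaleE. Qed.

Definition alift (G : lmodType K) (b : E -> F -> G) (t : atensor) : G :=
  fsum_eval b (arepr t).

Section Lift.
Variables (G : lmodType K) (b : E -> F -> G) (hb : bilinear_map b).

Lemma alift_api s : alift b (api s) = fsum_eval b s.
Proof. exact: arepr_eval. Qed.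

Lemma alift_linear : linear (alift b).
Proof.
move=> c t u; rewrite -[t]areprK -[u]areprK apiZ apiD !alift_api.
by rewrite fsum_eval_cat fsum_eval_scale.
Qed.

End Lift.

Lemma api_tens_bilinear : bilinear_map (fun x y => api [:: (x, y)]).
Proof.
split=> [y c x x'|x c y y']; rewrite apiZ apiD; apply/api_eq => G b hb;
  rewrite fsum_eval_cat fsum_eval_scale // /fsum_eval !big_seq1 /=.
- by rewrite bilinDl // bilinZl.
- by rewrite bilinDr // bilinZr.
Qed.

Lemma apiE s : api s = \sum_(p <- s) api [:: p].
Proof.
elim: s => [|p s ih]; first by rewrite big_nil.
by rewrite big_cons -ih apiD.
Qed.

End AlgTensor.

Section ProjSeminorm.
Context {R : realType}.
Variables E F : normedModType R[i].
Implicit Types (s : seq (E * F)) (t : atensor E F).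

Definition fsum_cost s : R := \sum_(p <- s) nrm p.1 * nrm p.2.

Definition proj_costs t : set R := [set fsum_cost s | s in [set s | api s = t]].

Definition proj_norm t : R := inf (proj_costs t).

Lemma fsum_cost_ge0 s : 0 <= fsum_cost s.
Proof. by apply: sumr_ge0 => p _; rewrite mulr_ge0 ?nrm_ge0. Qed.

Lemma proj_costs_inf t : has_inf (proj_costs t).
Proof.
split; first by exists (fsum_cost (arepr t)); exists (arepr t); rewrite //= areprK.
by exists 0 => _ [s _ <-]; exact: fsum_cost_ge0.
Qed.

Lemma proj_norm_le s : proj_norm (api s) <= fsum_cost s.
Proof. by apply: ge_inf; [case: (proj_costs_inf (api s))|exists s]. Qed.

Lemma le_proj_norm t a : (forall s, api s = t -> a <= fsum_cost s) ->
  a <= proj_norm t.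
Proof.
move=> h; apply: lb_le_inf; first by case: (proj_costs_inf t).
by move=> _ [s /= st <-]; exact: h.
Qed.

Lemma proj_norm_ge0 t : 0 <= proj_norm t.
Proof. by apply: le_proj_norm => s _; exact: fsum_cost_ge0. Qed.

Lemma proj_normD t u : proj_norm (t + u) <= proj_norm t + proj_norm u.
Proof.
rewrite -lerBlDr; apply: le_proj_norm => s st.
rewrite lerBlDr -lerBlDl; apply: le_proj_norm => s' su.
rewrite lerBlDl -st -su apiD (le_trans (proj_norm_le _)) //.
by rewrite /fsum_cost big_cat.
Qed.

Lemma proj_norm_scale_le c t : proj_norm (c *: t) <= complex.Re `|c| * proj_norm t.
Proof.
have := Re_norm_ge0 c; rewrite le_eqVlt => /predU1P[c0|c0].
  rewrite -c0 mul0r.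
  have -> : c = 0 by apply/normr0_eq0; rewrite -Re_normE -c0.
  rewrite scale0r -[0]/(api [::]) (le_trans (proj_norm_le _)) //.
  by rewrite /fsum_cost big_nil.
rewrite -ler_pdivrMl //; apply: le_proj_norm => s st.
rewrite ler_pdivrMl // -st apiZ (le_trans (proj_norm_le _)) //.
rewrite /fsum_cost big_map mulr_sumr ler_sum // => p _ /=.
by rewrite nrmZ mulrA.
Qed.

Lemma proj_norm_bounded (G : normedModType R[i]) (b : E -> F -> G) (M : R) :
  bilinear_map b -> 0 <= M ->
  (forall x y, nrm (b x y) <= M * nrm x * nrm y) ->
  forall t, nrm (alift b t) <= M * proj_norm t.
Proof.
move=> hb; rewrite le_eqVlt => /predU1P[<-|M0] bM t.
  rewrite mul0r (le_trans (nrm_sum _ _ _)) // big1 // => p _.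
  apply/eqP; rewrite eq_le nrm_ge0 andbT.
  by have := bM p.1 p.2; rewrite !mul0r.
rewrite -ler_pdivrMl //; apply: le_proj_norm => s st.
rewrite ler_pdivrMl // -st alift_api // (le_trans (nrm_sum _ _ _)) //.
by rewrite mulr_sumr ler_sum // => p _; rewrite mulrA.
Qed.

End ProjSeminorm.

(* The Hausdorff completion of a seminormed space: Cauchy sequences modulo null
   sequences, normed by the limit of the seminorms. *)
Record seminorm (R : realType) (V : lmodType R[i]) := Seminorm {
  seminorm_fun :> V -> R;
  seminormD : forall x y,
    seminorm_fun (x + y) <= seminorm_fun x + seminorm_fun y;
  seminormZ : forall c x,
    seminorm_fun (c *: x) = complex.Re `|c| * seminorm_fun x }.

Section SeminormTheory.
Context {R : realType} {V : lmodType R[i]} (p : seminorm V).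

Lemma seminorm0 : p 0 = 0.
Proof. by rewrite -(scale0r 0) seminormZ normr0 mul0r. Qed.

Lemma seminormN x : p (- x) = p x.
Proof. by rewrite -scaleN1r seminormZ normrN1 mul1r. Qed.

Lemma seminorm_ge0 x : 0 <= p x.
Proof.
have := seminormD p x (- x); rewrite subrr seminorm0 seminormN.
by rewrite -mulr2n pmulrn_lge0.
Qed.

Lemma seminormB x y : p (x - y) = p (y - x).
Proof. by rewrite -seminormN opprB. Qed.

Lemma seminorm_triangle x y z : p (x - z) <= p (x - y) + p (y - z).
Proof. by rewrite -[x - z](subrKA y) seminormD. Qed.

Lemma seminorm_dist x y : `|p x - p y| <= p (x - y).
Proof.
rewrite ler_norml lerNl opprB !lerBlDr; apply/andP; split.
  by rewrite seminormB -{1}[y](subrK x) seminormD.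
by rewrite -{1}[x](subrK y) seminormD.
Qed.

Lemma seq_cauchy_submod :
  submod_closed [pred u : nat -> V | `[< seq_cauchy p u >]].
Proof.
split=> [|a u v]; rewrite !inE.
  by move=> e e0; exists 0%N => m n _ _; rewrite subrr seminorm0.
move=> cu cv e e0.
have a1 : 0 < complex.Re `|a| + 1 by rewrite ltr_wpDl ?Re_norm_ge0.
have [N1 h1] := cu (e / 2 / (complex.Re `|a| + 1)) ltac:(rewrite !divr_gt0 //).
have [N2 h2] := cv (e / 2) ltac:(rewrite !divr_gt0 //).
exists (maxn N1 N2) => m n; rewrite !geq_max => /andP[m1 m2] /andP[n1 n2].
rewrite !fctE opprD addrACA -scalerBr (le_lt_trans (seminormD p _ _)) //.
rewrite [e]splitr ler_ltD ?h2 // seminormZ.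
have /ltW := h1 _ _ m1 n1; rewrite ler_pdivlMr // mulrC; apply: le_trans.
by rewrite ler_wpM2r ?seminorm_ge0 // lerDl.
Qed.

End SeminormTheory.

Definition seq_cauchy_pred (R : realType) (V : lmodType R[i])
  (p : seminorm V) : {pred nat -> V} := [pred u | `[< seq_cauchy p u >]].

HB.instance Definition _ (R : realType) (V : lmodType R[i])
    (p : seminorm V) :=
  GRing.isSubmodClosed.Build R[i] (nat -> V) (seq_cauchy_pred p)
    (seq_cauchy_submod p).

Record cauchy_seq (R : realType) (V : lmodType R[i]) (p : seminorm V) :=
  CauchySeq {
    cauchy_seq_fun :> nat -> V;
    cauchy_seq_subproof : cauchy_seq_fun \in seq_cauchy_pred p }.

Section CauchySeqTheory.
Context {R : realType} {V : lmodType R[i]} (p : seminorm V).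

HB.instance Definition _ := [isSub for @cauchy_seq_fun R V p].
HB.instance Definition _ := [Choice of cauchy_seq p by <:].
HB.instance Definition _ := [SubChoice_isSubLmodule of cauchy_seq p by <:].

Definition null_seq_pred : {pred cauchy_seq p} :=
  [pred u : cauchy_seq p | `[< seq_cvg p u 0 >]].

Lemma null_seq_submod : submod_closed null_seq_pred.
Proof.
split=> [|a u v]; rewrite !inE.
  by move=> e e0; exists 0%N => n _; rewrite subr0 seminorm0.
move=> cu cv e e0.
have a1 : 0 < complex.Re `|a| + 1 by rewrite ltr_wpDl ?Re_norm_ge0.
have [N1 h1] := cu (e / 2 / (complex.Re `|a| + 1)) ltac:(rewrite !divr_gt0 //).
have [N2 h2] := cv (e / 2) ltac:(rewrite !divr_gt0 //).
exists (maxn N1 N2) => n; rewrite !geq_max => /andP[n1 n2].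
have := h2 _ n2; have := h1 _ n1; rewrite !subr0 => un vn.
rewrite (le_lt_trans (seminormD p _ _)) // [e]splitr ler_ltD //.
rewrite seminormZ.
have /ltW := un; rewrite ler_pdivlMr // mulrC; apply: le_trans.
by rewrite ler_wpM2r ?seminorm_ge0 // lerDl.
Qed.

HB.instance Definition _ :=
  GRing.isSubmodClosed.Build R[i] (cauchy_seq p) null_seq_pred null_seq_submod.

Lemma cauchy_seqP (u : cauchy_seq p) : seq_cauchy p u.
Proof. by case: u => u uP; apply/(asboolP _). Qed.

Definition mk_cauchy (u : nat -> V) (hu : seq_cauchy p u) : cauchy_seq p :=
  CauchySeq (introT (asboolP _) hu).

End CauchySeqTheory.

Definition completion (R : realType) (V : lmodType R[i]) (p : seminorm V) :
  Type := lquot (@null_seq_pred R V p).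

Section Completion.
Context {R : realType} {V : lmodType R[i]} (p : seminorm V).
Implicit Types (u v : cauchy_seq p) (q : completion p).

HB.instance Definition _ := GRing.Lmodule.on (completion p).

Definition cpi u : completion p := lpi (@null_seq_pred R V p) u.
Definition crepr q : cauchy_seq p := lrepr q.

Lemma creprK q : cpi (crepr q) = q. Proof. exact: lreprK. Qed.

Lemma cpiD u v : cpi (u + v) = cpi u + cpi v. Proof. exact: lpiD. Qed.
Lemma cpiB u v : cpi (u - v) = cpi u - cpi v. Proof. exact: lpiB. Qed.
Lemma cpiZ c u : cpi (c *: u) = c *: cpi u. Proof. exact: lpiZ. Qed.

Lemma cpi_eq0 u : cpi u = 0 <-> seq_cvg p u 0.
Proof.
apply: iff_trans (lpi_eq0 _ _) _.
by split=> [h|h]; [apply/asboolP|apply/asboolP].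
Qed.

Lemma cauchy_seq_lim u : exists l : R, forall e : R, 0 < e ->
  exists N, forall n, (N <= n)%N -> `|p (u n) - l| < e.
Proof.
apply: R_seq_cauchy => e /(cauchy_seqP u)[N hN]; exists N => m n hm hn.
by rewrite (le_lt_trans (seminorm_dist _ _ _)) // hN.
Qed.

Definition lim_norm u : R := sval (cid (cauchy_seq_lim u)).

Lemma lim_normP u (e : R) : 0 < e ->
  exists N, forall n, (N <= n)%N -> `|p (u n) - lim_norm u| < e.
Proof. exact: (svalP (cid (cauchy_seq_lim u))). Qed.

Lemma lim_norm_le u a : (exists N, forall n, (N <= n)%N -> p (u n) <= a) ->
  lim_norm u <= a.
Proof.
move=> [N hN]; apply/ler_addgt0Pr => e e0.
have [N' hN'] := lim_normP u e0.
have := hN' _ (leq_maxr N N'); rewrite distrC ltr_norml => /andP[_].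
rewrite ltrBlDr => /ltW /le_trans; apply.
by rewrite addrC lerD2r hN // leq_maxl.
Qed.

Lemma lim_norm_ge u a : (exists N, forall n, (N <= n)%N -> a <= p (u n)) ->
  a <= lim_norm u.
Proof.
move=> [N hN]; apply/ler_addgt0Pr => e e0.
have [N' hN'] := lim_normP u e0.
have := hN' _ (leq_maxr N N'); rewrite ltr_norml => /andP[_].
rewrite ltrBlDr => /ltW; rewrite addrC; apply: le_trans.
by rewrite hN // leq_maxl.
Qed.

Lemma lim_norm_eventually u (e : R) : 0 < e ->
  exists N, forall n, (N <= n)%N -> p (u n) <= lim_norm u + e.
Proof.
move=> e0; have [N hN] := lim_normP u e0; exists N => n /hN.
by rewrite ltr_norml => /andP[_]; rewrite ltrBlDr addrC => /ltW.
Qed.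

Lemma lim_norm_ge0 u : 0 <= lim_norm u.
Proof. by apply: lim_norm_ge; exists 0%N => n _; exact: seminorm_ge0. Qed.

Lemma lim_normD u v : lim_norm (u + v) <= lim_norm u + lim_norm v.
Proof.
apply/ler_addgt0Pr => e e0; have e2 : 0 < e / 2 by rewrite divr_gt0.
have [N1 h1] := lim_norm_eventually u e2.
have [N2 h2] := lim_norm_eventually v e2.
apply: lim_norm_le; exists (maxn N1 N2) => n; rewrite geq_max => /andP[n1 n2].
rewrite (le_trans (seminormD p _ _)) // [e]splitr addrACA.
by rewrite lerD ?h1 ?h2.
Qed.

Lemma lim_normZ_le c u : lim_norm (c *: u) <= complex.Re `|c| * lim_norm u.
Proof.
apply/ler_addgt0Pr => e e0.
have c1 : 0 < complex.Re `|c| + 1 by rewrite ltr_wpDl ?Re_norm_ge0.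
have ec : 0 < e / (complex.Re `|c| + 1) by rewrite divr_gt0.
have [N hN] := lim_norm_eventually u ec.
apply: lim_norm_le; exists N => n /hN un.
rewrite -[(c *: u) n]/(c *: u n) seminormZ.
rewrite (le_trans (ler_wpM2l (Re_norm_ge0 c) un)) // mulrDr lerD2l.
rewrite mulrCA ger_pMr // ler_pdivrMr // mul1r.
by rewrite lerDl.
Qed.

Lemma lim_norm_null u : lim_norm u = 0 <-> cpi u = 0.
Proof.
split=> [u0|/cpi_eq0 u0].
  apply/cpi_eq0 => e e0; have [N hN] := lim_normP u e0.
  exists N => n /hN; rewrite u0 !subr0.
  by rewrite ger0_norm // seminorm_ge0.
apply/eqP; rewrite eq_le lim_norm_ge0 andbT.
apply/ler_addgt0Pr => e e0; rewrite add0r.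
apply: lim_norm_le; have [N hN] := u0 _ e0; exists N => n /hN.
by rewrite subr0 => /ltW.
Qed.

Lemma lim_norm_eq u v : cpi u = cpi v -> lim_norm u = lim_norm v.
Proof.
suff le w w' : cpi w = cpi w' -> lim_norm w <= lim_norm w'.
  by move=> uv; apply/eqP; rewrite eq_le !le.
move=> ww'; have /lim_norm_null w0 : cpi (w - w') = 0.
  by rewrite cpiB ww' subrr.
by rewrite -[w](subrK w') (le_trans (lim_normD _ _)) // w0 add0r.
Qed.

Definition cnorm q : R := lim_norm (crepr q).

Lemma cnormE u : cnorm (cpi u) = lim_norm u.
Proof. by apply: lim_norm_eq; rewrite creprK. Qed.

Fact cnormD q q' : (cnorm (q + q'))%:C <= (cnorm q)%:C + (cnorm q')%:C.
Proof.
rewrite -rmorphD lecR -[q]creprK -[q']creprK -cpiD !cnormE.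
exact: lim_normD.
Qed.

Fact cnormZ (c : R[i]) q : (cnorm (c *: q))%:C = `|c| * (cnorm q)%:C.
Proof.
rewrite -[q]creprK -cpiZ !cnormE; move: (crepr q) => {q} u.
rewrite -Re_normE -rmorphM; congr (_%:C).
apply/eqP; rewrite eq_le lim_normZ_le andTb.
have [->|c0] := eqVneq c 0.
  by rewrite normr0 mul0r lim_norm_ge0.
have := lim_normZ_le c^-1 (c *: u); rewrite scalerA mulVf // scale1r.
have -> : complex.Re `|c^-1| = (complex.Re `|c|)^-1.
  by apply: complexI; rewrite fmorphV !Re_normE normfV.
by rewrite ler_pdivlMl // -ltcR Re_normE normr_gt0.
Qed.

Fact cnorm_eq0 q : (cnorm q)%:C = 0 -> q = 0.
Proof.
move=> /complexI; rewrite -[q]creprK cnormE; exact: (lim_norm_null _).1.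
Qed.

HB.instance Definition _ :=
  Lmodule_isNormed.Build R[i] (completion p) cnormD cnormZ cnorm_eq0.

Lemma nrm_cpi u : nrm (cpi u) = lim_norm u.
Proof. exact: cnormE. Qed.

Lemma const_cauchy (x : V) : seq_cauchy p (fun=> x).
Proof. by move=> e e0; exists 0%N => m n _ _; rewrite subrr seminorm0. Qed.

Definition cinj (x : V) : completion p := cpi (mk_cauchy (const_cauchy x)).

Lemma cinj_linear : linear cinj.
Proof.
move=> c x y; rewrite /cinj -cpiZ -cpiD; congr cpi.
exact/val_inj.
Qed.

Lemma cinjB x y : cinj (x - y) = cinj x - cinj y.
Proof. by rewrite /cinj -cpiB; congr cpi; exact/val_inj. Qed.

Lemma nrm_cinj x : nrm (cinj x) = p x.
Proof.
rewrite nrm_cpi; apply/eqP; rewrite eq_le lim_norm_le ?lim_norm_ge //;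
  by exists 0%N.
Qed.

Lemma cpi_cvg u : seq_cvg (@nrm R (completion p)) (fun n => cinj (u n)) (cpi u).
Proof.
move=> e e0; have e2 : 0 < e / 2 by rewrite divr_gt0.
have [N hN] := cauchy_seqP u e2; exists N => n Nn.
rewrite /cinj -cpiB nrm_cpi; apply: (@le_lt_trans _ _ (e / 2)).
  apply: lim_norm_le; exists N => m Nm.
  by apply/ltW; exact: hN.
by rewrite ltr_pdivrMr // mulr_natr mulr2n ltrDl.
Qed.

Lemma cinj_dense q (e : R) : 0 < e -> exists x, nrm (q - cinj x) < e.
Proof.
move=> e0; have [N hN] := cpi_cvg (crepr q) e0.
exists (crepr q N); rewrite nrmB -[X in _ - X]creprK.
exact: hN.
Qed.

Lemma completion_complete (F : set_system (completion p)) :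
  ProperFilter F -> cauchy F -> cvg F.
Proof.
apply: seq_complete => w cw.
pose eps n : R := (n.+1%:R)^-1.
have eps0 n : 0 < eps n by rewrite invr_gt0 ltr0n.
have small e : 0 < e -> exists N, forall n, (N <= n)%N -> eps n < e.
  move=> e0; exists (Num.bound (e^-1)) => n hn.
  rewrite /eps -[e]invrK ltf_pV2 ?posrE ?ltr0n ?invr_gt0 //.
  have e1 : 0 <= e^-1 by rewrite invr_ge0 ltW.
  apply: (lt_le_trans (archi_boundP e1)).
  by rewrite ler_nat; exact: leq_trans hn (leqnSn _).
pose x n := sval (cid (cinj_dense (w n) (eps0 n))).
have wx n : nrm (w n - cinj (x n)) < eps n.
  exact: svalP (cid (cinj_dense (w n) (eps0 n))).
have cx : seq_cauchy p x.
  move=> e e0; have e3 : 0 < e / 3 by rewrite divr_gt0.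
  have [N1 h1] := cw _ e3; have [N2 h2] := small _ e3.
  exists (maxn N1 N2) => m n; rewrite !geq_max => /andP[m1 m2] /andP[n1 n2].
  rewrite -nrm_cinj cinjB.
  rewrite (le_lt_trans (nrm_triangle _ (w m) _)) //.
  have -> : e = e / 3 + (e / 3 + e / 3) by lra.
  rewrite ltrD //; first by rewrite nrmB (lt_trans (wx _)) // h2.
  rewrite (le_lt_trans (nrm_triangle _ (w n) _)) // ltrD //.
    exact: h1.
  by rewrite (lt_trans (wx _)) // h2.
exists (cpi (mk_cauchy cx)) => e e0; have e2 : 0 < e / 2 by rewrite divr_gt0.
have [N1 h1] := small _ e2; have [N2 h2] := cpi_cvg (mk_cauchy cx) e2.
exists (maxn N1 N2) => n; rewrite !geq_max => /andP[n1 n2].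
rewrite (le_lt_trans (nrm_triangle _ (cinj (x n)) _)) // [e]splitr ltrD //.
  by rewrite (lt_trans (wx _)) // h1.
exact: h2.
Qed.

HB.instance Definition _ :=
  Uniform_isComplete.Build (completion p) completion_complete.

End Completion.

Section CompletionLift.
Context {R : realType} {V : lmodType R[i]} (p : seminorm V).
Context {G : completeNormedModType R[i]}.
Variables (f : V -> G) (M : R).
Hypotheses (fl : linear f) (fM : forall x, nrm (f x) <= M * p x).

Lemma seq_cvg_unique (u : nat -> G) l l' :
  seq_cvg (@nrm R G) u l -> seq_cvg (@nrm R G) u l' -> l = l'.
Proof.
move=> ul ul'; apply/eqP; rewrite -subr_eq0; apply/eqP/nrm_eq0.
apply/eqP; rewrite eq_le nrm_ge0 andbT; apply/ler_addgt0Pr => e e0.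
have e2 : 0 < e / 2 by rewrite divr_gt0.
have [N1 h1] := ul _ e2; have [N2 h2] := ul' _ e2.
rewrite add0r (le_trans (nrm_triangle _ (u (maxn N1 N2)) _)) //.
rewrite [e]splitr lerD //; last by rewrite ltW // h2 // leq_maxr.
by rewrite nrmB ltW // h1 // leq_maxl.
Qed.

Let fB x y : f (x - y) = f x - f y.
Proof. by rewrite -[- y]scaleN1r addrC fl scaleN1r addrC. Qed.

Lemma lift_seq_cauchy (u : cauchy_seq p) :
  seq_cauchy (@nrm R G) (fun n => f (u n)).
Proof.
move=> e e0; have M1 : 0 < `|M| + 1 by rewrite ltr_wpDl.
have eM : 0 < e / (`|M| + 1) by rewrite divr_gt0.
have [N hN] := cauchy_seqP u eM; exists N => m n hm hn.
rewrite -fB (le_lt_trans (fM _)) //.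
have := hN _ _ hm hn; rewrite ltr_pdivlMr // mulrC; apply: le_lt_trans.
by rewrite ler_wpM2r ?seminorm_ge0 // (le_trans (ler_norm M)) // lerDl.
Qed.

Definition clift_fun (q : completion p) : G :=
  sval (cid (seq_cauchy_cvg (lift_seq_cauchy (crepr q)))).

Lemma clift_funP (u : cauchy_seq p) :
  seq_cvg (@nrm R G) (fun n => f (u n)) (clift_fun (cpi u)).
Proof.
have hq := svalP (cid (seq_cauchy_cvg (lift_seq_cauchy (crepr (cpi u))))).
move=> e e0; have e2 : 0 < e / 2 by rewrite divr_gt0.
have M1 : 0 < `|M| + 1 by rewrite ltr_wpDl.
have eM : 0 < e / 2 / (`|M| + 1) by rewrite divr_gt0.
have [N1 h1] := hq _ e2.
have /cpi_eq0 d : cpi (u - crepr (cpi u)) = 0 by rewrite cpiB creprK subrr.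
have [N2 h2] := d _ eM.
exists (maxn N1 N2) => n; rewrite geq_max => /andP[n1 n2].
rewrite (le_lt_trans (nrm_triangle _ (f (crepr (cpi u) n)) _)) //.
rewrite [e]splitr ltrD //; last exact: h1.
rewrite -fB (le_lt_trans (fM _)) //.
have := h2 _ n2; rewrite subr0 ltr_pdivlMr // mulrC; apply: le_lt_trans.
by rewrite ler_wpM2r ?seminorm_ge0 // (le_trans (ler_norm M)) // lerDl.
Qed.

Lemma clift_fun_bounded : bounded_linear clift_fun.
Proof.
split=> [c q q'|].
  rewrite -[q]creprK -[q']creprK -cpiZ -cpiD.
  move: (crepr q) (crepr q') => {q q'} u v.
  apply: (@seq_cvg_unique (fun n => f ((c *: u + v) n))).
    exact: clift_funP.
  move=> e e0; have e2 : 0 < e / 2 by rewrite divr_gt0.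
  have c1 : 0 < complex.Re `|c| + 1 by rewrite ltr_wpDl ?Re_norm_ge0.
  have ec : 0 < e / 2 / (complex.Re `|c| + 1) by rewrite divr_gt0.
  have [N1 h1] := clift_funP u ec; have [N2 h2] := clift_funP v e2.
  exists (maxn N1 N2) => n; rewrite geq_max => /andP[n1 n2].
  rewrite -[(c *: u + v) n]/(c *: u n + v n) fl opprD addrACA -scalerBr.
  rewrite (le_lt_trans (nrmD _ _)) // [e]splitr ler_ltD ?h2 // nrmZ.
  have /ltW := h1 _ n1; rewrite ler_pdivlMr // mulrC; apply: le_trans.
  by rewrite ler_wpM2r ?nrm_ge0 // lerDl.
exists `|M| => q; rewrite -[q]creprK nrm_cpi; move: (crepr q) => {q} u.
apply/ler_addgt0Pr => e e0; have e2 : 0 < e / 2 by rewrite divr_gt0.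
have M1 : 0 < `|M| + 1 by rewrite ltr_wpDl.
have eM : 0 < e / 2 / (`|M| + 1) by rewrite divr_gt0.
have [N1 h1] := clift_funP u e2; have [N2 h2] := lim_norm_eventually u eM.
pose n := maxn N1 N2.
rewrite -[clift_fun _](subrK (f (u n))) (le_trans (nrmD _ _)) //.
rewrite [e]splitr addrCA lerD //.
  by rewrite nrmB ltW // h1 // leq_maxl.
rewrite (le_trans (fM _)) //.
have h : p (u n) <= lim_norm u + e / 2 / (`|M| + 1) by rewrite h2 // leq_maxr.
rewrite (@le_trans _ _ (`|M| * p (u n))) ?ler_wpM2r ?seminorm_ge0 ?ler_norm //.
rewrite (le_trans (ler_wpM2l _ h)) // mulrDr lerD2l.
rewrite mulrCA ger_pMr // ler_pdivrMr // mul1r.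
by rewrite lerDl.
Qed.

Definition clift : bmap (completion p) G := mkbmap clift_fun_bounded.

Lemma cliftE x : clift (cinj p x) = f x.
Proof.
apply: (@seq_cvg_unique (fun=> f x)); first exact: (clift_funP (mk_cauchy (const_cauchy p x))).
by move=> e e0; exists 0%N => n _; rewrite subrr nrm0.
Qed.

End CompletionLift.

Lemma completion_ext (R : realType) (V : lmodType R[i]) (p : seminorm V)
    (G : normedModType R[i]) (f g : bmap (completion p) G) :
  (forall x, f (cinj p x) = g (cinj p x)) -> f = g.
Proof.
move=> fg; apply/eqP; rewrite -subr_eq0; apply/eqP.
apply: bmap_ext => q; apply: nrm_eq0; apply/eqP.
rewrite eq_le nrm_ge0 andbT; apply/ler_addgt0Pr => e e0; rewrite add0r.
set h := f - g; have h1 : 0 < opnorm h + 1 by rewrite ltr_wpDl ?opnorm_ge0.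
have [x hx] := cinj_dense q (divr_gt0 e0 h1).
have -> : h q = h (q - cinj p x).
  by rewrite bmapBr [h (cinj p x)]bmapBl fg subrr subr0.
rewrite (le_trans (opnormP _ _)) //.
have := ltW hx; rewrite ler_pdivlMr // mulrC; apply: le_trans.
by rewrite ler_wpM2r ?nrm_ge0 // lerDl.
Qed.

Fact proj_normZ (R : realType) (E F : normedModType R[i]) c (t : atensor E F) :
  proj_norm (c *: t) = complex.Re `|c| * proj_norm t.
Proof.
apply/eqP; rewrite eq_le proj_norm_scale_le andTb.
have [->|c0] := eqVneq c 0; first by rewrite normr0 mul0r proj_norm_ge0.
have := proj_norm_scale_le c^-1 (c *: t); rewrite scalerA mulVf // scale1r.
have -> : complex.Re `|c^-1| = (complex.Re `|c|)^-1.
  by apply: complexI; rewrite fmorphV !Re_normE normfV.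
by rewrite ler_pdivlMl // -ltcR Re_normE normr_gt0.
Qed.

Definition proj_seminorm (R : realType) (E F : normedModType R[i]) :
    seminorm (atensor E F) :=
  Seminorm (@proj_normD R E F) (@proj_normZ R E F).

Definition ptensor (R : realType) (E F : normedModType R[i]) :
    completeNormedModType R[i] :=
  completion (proj_seminorm E F).

Definition bounded_bilinear (R : realType) (E F G : normedModType R[i])
    (b : E -> F -> G) : Prop :=
  bilinear_map b /\
  exists M : R, forall x y, nrm (b x y) <= M * nrm x * nrm y.

Section ProjTensor.
Context {R : realType} {E F : normedModType R[i]}.

Definition tens (x : E) (y : F) : ptensor E F :=
  cinj (proj_seminorm E F) (api [:: (x, y)]).

Lemma nrm_tens_le x y : nrm (tens x y) <= nrm x * nrm y.
Proof.
rewrite nrm_cinj (le_trans (proj_norm_le _)) //.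
by rewrite /fsum_cost big_seq1.
Qed.

Lemma tens_bilinear : bilinear_map tens.
Proof.
have [hl hr] := @api_tens_bilinear _ E F.
split=> [y c x x'|x c y y'].
  by rewrite /tens hl cinj_linear.
by rewrite /tens hr cinj_linear.
Qed.

Lemma ptensor_ext (G : normedModType R[i]) (f g : bmap (ptensor E F) G) :
  (forall x y, f (tens x y) = g (tens x y)) -> f = g.
Proof.
move=> fg; apply: completion_ext => t; rewrite -[t]areprK.
elim: (arepr t) => [|[x y] s ih].
  have -> : cinj (proj_seminorm E F) (api [::]) = 0.
    by have := cinjB (proj_seminorm E F) 0 0; rewrite subrr => ->; rewrite subrr.
  by rewrite !bmap0r.
rewrite -cat1s -apiD -[api [:: _]]scale1r cinj_linear !bmap_linear ih.
by rewrite -[cinj _ _]/(tens x y) fg.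
Qed.

Section Lift.
Variables (G : completeNormedModType R[i]) (b : E -> F -> G).
Hypothesis hb : bounded_bilinear b.

Fact alift_bounded (t : atensor E F) :
  nrm (alift b t) <= `|sval (cid hb.2)| * proj_seminorm E F t.
Proof.
apply: proj_norm_bounded; [exact: hb.1|exact: normr_ge0|] => x y.
rewrite (le_trans (svalP (cid hb.2) x y)) // ler_wpM2r ?nrm_ge0 //.
by rewrite ler_wpM2r ?nrm_ge0 // ler_norm.
Qed.

(* the bounded linear map on the projective tensor product implemented by a
   bounded bilinear map *)
Definition tlift : bmap (ptensor E F) G :=
  clift (alift_linear hb.1) alift_bounded.

Lemma tliftE x y : tlift (tens x y) = b x y.
Proof.
rewrite /tlift cliftE alift_api ?/fsum_eval ?big_seq1 //; exact: hb.1.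
Qed.

End Lift.
End ProjTensor.

Definition linear_subset (K : pzRingType) (V : lmodType K) (S : set V) : Prop :=
  S 0 /\ forall c x y, S x -> S y -> S (c *: x + y).

Definition closed_span (R : realType) (V : normedModType R[i]) (X : set V) :
    set V :=
  smallest [set S | linear_subset S /\ closed S] X.

Definition closed_span_pred (R : realType) (V : normedModType R[i])
  (X : set V) : {pred V} := [pred x | `[< closed_span X x >]].

Section ClosedSpan.
Context {R : realType} {V : normedModType R[i]} (X : set V).

Lemma closed_span_pred_submod : submod_closed (closed_span_pred X).
Proof.
split=> [|c x y]; rewrite !inE.
  by move=> S [[[S0 _] _] _].
by move=> hx hy S hS; apply: hS.1.1.2; [exact: hx|exact: hy].
Qed.

HB.instance Definition _ :=
  GRing.isSubmodClosed.Build R[i] V (closed_span_pred X)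
    closed_span_pred_submod.

Lemma closed_spanP x : x \in closed_span_pred X <-> closed_span X x.
Proof. by split=> /asboolP. Qed.

Lemma closed_span_closed : closed (closed_span X).
Proof. by apply: closed_bigI => S [[_ hS] _]. Qed.

Lemma closed_span_approx x :
  (forall e : R, 0 < e -> exists2 y, closed_span X y & nrm (x - y) < e) ->
  closed_span X x.
Proof.
move=> h; apply: closed_span_closed => B /nbhs_ballP[e /gt0_complexP[r r0 ->]].
move=> hB; have [y Xy xy] := h _ r0; exists y; split => //.
by apply: hB; apply/nrm_ballP.
Qed.

End ClosedSpan.

Definition nquot (R : realType) (V : normedModType R[i]) (X : set V) : Type :=
  lquot (closed_span_pred X).

Section Nquot.
Context {R : realType} {V : normedModType R[i]} (X : set V).
Implicit Types (q : nquot X).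

HB.instance Definition _ := GRing.Lmodule.on (nquot X).

Definition npi (x : V) : nquot X := lpi (closed_span_pred X) x.
Definition nrepr q : V := lrepr q.

Lemma nreprK q : npi (nrepr q) = q. Proof. exact: lreprK. Qed.
Lemma npiD x y : npi (x + y) = npi x + npi y. Proof. exact: lpiD. Qed.
Lemma npiZ c x : npi (c *: x) = c *: npi x. Proof. exact: lpiZ. Qed.

Lemma npi_eq x y : npi x = npi y <-> closed_span X (x - y).
Proof. by apply: iff_trans (closed_spanP _ _); exact: lpi_eq. Qed.

Definition qnorm q : R := inf [set nrm x | x in [set x | npi x = q]].

Lemma qnorm_has_inf q : has_inf [set nrm x | x in [set x | npi x = q]].
Proof.
split; first by exists (nrm (nrepr q)); exists (nrepr q); rewrite //= nreprK.
by exists 0 => _ [x _ <-]; exact: nrm_ge0.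
Qed.

Lemma qnorm_le x : qnorm (npi x) <= nrm x.
Proof. by apply: ge_inf; [case: (qnorm_has_inf (npi x))|exists x]. Qed.

Lemma le_qnorm q a : (forall x, npi x = q -> a <= nrm x) -> a <= qnorm q.
Proof.
move=> h; apply: lb_le_inf; first by case: (qnorm_has_inf q).
by move=> _ [x /= xq <-]; exact: h.
Qed.

Lemma qnorm_lt q (e : R) : qnorm q < e -> exists2 x, npi x = q & nrm x < e.
Proof.
move=> qe; apply: contrapT => h; move: qe; apply/negP; rewrite -leNgt.
apply: le_qnorm => x xq; rewrite leNgt; apply/negP => xe.
by apply: h; exists x.
Qed.

Lemma qnorm_ge0 q : 0 <= qnorm q.
Proof. by apply: le_qnorm => x _; exact: nrm_ge0. Qed.

Fact qnormD q q' : (qnorm (q + q'))%:C <= (qnorm q)%:C + (qnorm q')%:C.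
Proof.
rewrite -rmorphD lecR -lerBlDr; apply: le_qnorm => x xq.
rewrite lerBlDr -lerBlDl; apply: le_qnorm => y yq.
by rewrite lerBlDl -xq -yq -npiD (le_trans (qnorm_le _)) // nrmD.
Qed.

Lemma qnormZ_le c q : qnorm (c *: q) <= complex.Re `|c| * qnorm q.
Proof.
have := Re_norm_ge0 c; rewrite le_eqVlt => /predU1P[c0|c0].
  rewrite -c0 mul0r -[q]nreprK -npiZ (le_trans (qnorm_le _)) //.
  by rewrite nrmZ -c0 mul0r.
rewrite -ler_pdivrMl //; apply: le_qnorm => x xq.
by rewrite ler_pdivrMl // -xq -npiZ (le_trans (qnorm_le _)) // nrmZ.
Qed.

Fact qnormZ (c : R[i]) q : (qnorm (c *: q))%:C = `|c| * (qnorm q)%:C.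
Proof.
rewrite -Re_normE -rmorphM; congr (_%:C).
apply/eqP; rewrite eq_le qnormZ_le andTb.
have [->|c0] := eqVneq c 0; first by rewrite normr0 mul0r qnorm_ge0.
have := qnormZ_le c^-1 (c *: q); rewrite scalerA mulVf // scale1r.
have -> : complex.Re `|c^-1| = (complex.Re `|c|)^-1.
  by apply: complexI; rewrite fmorphV !Re_normE normfV.
by rewrite ler_pdivlMl // -ltcR Re_normE normr_gt0.
Qed.

Fact qnorm_eq0 q : (qnorm q)%:C = 0 -> q = 0.
Proof.
move=> /complexI q0; rewrite -[q]nreprK -[0](lpi0 (closed_span_pred X)).
apply/npi_eq; rewrite subr0; apply: closed_span_approx => e e0.
have [|x xq xe] := @qnorm_lt q e; first by rewrite q0.
exists (nrepr q - x); last by rewrite opprB addrC subrK.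
by apply/npi_eq; rewrite nreprK xq.
Qed.

HB.instance Definition _ :=
  Lmodule_isNormed.Build R[i] (nquot X) qnormD qnormZ qnorm_eq0.

Section Lift.
Variables (G : normedModType R[i]) (f : bmap V G).
Hypothesis fX : forall x, X x -> f x = 0.

Lemma bmap_closed_span x : closed_span X x -> f x = 0.
Proof.
move=> h; apply: (h [set z | f z = 0]) => {x h}; split; last by [].
split.
  split=> [|c x y /= hx hy]; first by rewrite /= bmap0r.
  by rewrite bmap_linear hx hy scaler0 addr0.
move=> x /= clx; apply: nrm_eq0; apply/eqP.
rewrite eq_le nrm_ge0 andbT; apply/ler_addgt0Pr => e e0; rewrite add0r.
have f1 : 0 < opnorm f + 1 by rewrite ltr_wpDl ?opnorm_ge0.
have ef : 0 < e / (opnorm f + 1) by rewrite divr_gt0.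
have [|y [/= fy /nrm_ballP xy]] := clx (ball x ((e / (opnorm f + 1))%:C)).
  by apply: nbhsx_ballx; rewrite ltcR.
rewrite -[f x]subr0 -fy -bmapBr (le_trans (opnormP _ _)) //.
have := ltW xy; rewrite ler_pdivlMr // mulrC; apply: le_trans.
by rewrite ler_wpM2r ?nrm_ge0 // lerDl.
Qed.

Lemma nquot_lift_wd x y : npi x = npi y -> f x = f y.
Proof.
move=> /npi_eq/bmap_closed_span; rewrite bmapBr => /eqP.
by rewrite subr_eq0 => /eqP.
Qed.

Fact nquot_lift_bounded : bounded_linear (fun q => f (nrepr q)).
Proof.
split=> [c q q'|].
  rewrite -bmap_linear; apply: nquot_lift_wd.
  by rewrite npiD npiZ !nreprK.
exists (opnorm f) => q; have := opnorm_ge0 f; rewrite le_eqVlt.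
case/predU1P => [f0|f0].
  by rewrite (le_trans (opnormP _ _)) // -f0 !mul0r.
rewrite -ler_pdivrMl //; apply: le_qnorm => x xq.
rewrite ler_pdivrMl // (@nquot_lift_wd _ x) ?opnormP //.
by rewrite nreprK.
Qed.

Definition nquot_lift : bmap (nquot X) G := mkbmap nquot_lift_bounded.

Lemma nquot_liftE x : nquot_lift (npi x) = f x.
Proof. by apply: nquot_lift_wd; rewrite nreprK. Qed.

End Lift.
End Nquot.

HB.mixin Record isBanachAlgebra (R : realType) A
    of CompleteNormedModule R[i] A := {
  bmul : A -> A -> A;
  bmulA : associative bmul;
  bmul_linearl : forall b, linear (bmul^~ b);
  bmul_linearr : forall a, linear (bmul a);
  bmul_norm : forall a b, `|bmul a b| <= `|a| * `|b| }.

(* Complex Banach algebras, not necessarily unital. *)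
#[short(type="banachAlgType")]
HB.structure Definition BanachAlgebra (R : realType) :=
  {A of isBanachAlgebra R A & CompleteNormedModule R[i] A}.

Section BanachAlgebraTheory.
Context {R : realType} {A : banachAlgType R}.
Implicit Types a b c : A.

Lemma nrm_bmul a b : nrm (bmul a b) <= nrm a * nrm b.
Proof. by rewrite -lecR rmorphM /= -!nrmE bmul_norm. Qed.

Lemma bmul_bilinear : bilinear_map (@bmul R A).
Proof. by split=> ?; [exact: bmul_linearl|exact: bmul_linearr]. Qed.

Lemma bmul_bounded_bilinear : bounded_bilinear (@bmul R A).
Proof.
split; first exact: bmul_bilinear.
by exists 1 => a b; rewrite mul1r nrm_bmul.
Qed.

Lemma bmulDl a b c : bmul (a + b) c = bmul a c + bmul b c.
Proof. exact: (bilinDl bmul_bilinear). Qed.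

Lemma bmulDr a b c : bmul a (b + c) = bmul a b + bmul a c.
Proof. exact: (bilinDr bmul_bilinear). Qed.

Lemma bmul0l b : bmul 0 b = 0.
Proof. exact: (bilin0l bmul_bilinear). Qed.

Lemma bmul0r a : bmul a 0 = 0.
Proof. exact: (bilin0r bmul_bilinear). Qed.

Lemma bmul_suml (I : Type) (s : seq I) (P : pred I) (F : I -> A) b :
  bmul (\sum_(i <- s | P i) F i) b = \sum_(i <- s | P i) bmul (F i) b.
Proof. by elim/big_rec2: _ => [|i x y _ <-]; rewrite ?bmul0l ?bmulDl. Qed.

Lemma bmul_sumr (I : Type) (s : seq I) (P : pred I) (F : I -> A) a :
  bmul a (\sum_(i <- s | P i) F i) = \sum_(i <- s | P i) bmul a (F i).
Proof. by elim/big_rec2: _ => [|i x y _ <-]; rewrite ?bmul0r ?bmulDr. Qed.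

End BanachAlgebraTheory.

Section SelfInduced.
Context {R : realType}.
Variable A : banachAlgType R.

Definition balanced_relations : set (ptensor A A) :=
  [set t | exists a b c : A,
     t = tens (bmul a b) c - tens a (bmul b c)].

(* [nquot X] is the quotient by the closed linear span of [X]. *)
Definition btensor : normedModType R[i] := nquot balanced_relations.

Definition ptensor_mul : bmap (ptensor A A) A :=
  tlift (@bmul_bounded_bilinear R A).

Lemma ptensor_mul_balanced t : balanced_relations t -> ptensor_mul t = 0.
Proof.
by move=> [a [b [c ->]]]; rewrite bmapBr !tliftE bmulA subrr.
Qed.

Definition btensor_mul : bmap btensor A := nquot_lift ptensor_mul_balanced.

Definition self_induced : Prop :=
  exists g : bmap A btensor, cancel btensor_mul g /\ cancel g btensor_mul.

End SelfInduced.

(* The algebra of n x n matrices over a Banach algebra, normed by the sum of the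
   norms of the entries. *)
Definition matalg (R : realType) (A : banachAlgType R) (n : nat) : Type :=
  'M[A]_n.

Section MatAlg.
Context {R : realType} {A : banachAlgType R} {n : nat}.
Local Notation M := (matalg A n).
Implicit Types (a b : M).

HB.instance Definition _ := GRing.Zmodule.copy M 'M[A]_n.

Definition mat_scale (c : R[i]) (a : M) : M := \matrix_(i, j) (c *: a i j).

Fact mat_scaleA c d a : mat_scale c (mat_scale d a) = mat_scale (c * d) a.
Proof. by apply/matrixP => i j; rewrite !mxE scalerA. Qed.

Fact mat_scale1 : left_id 1 mat_scale.
Proof. by move=> a; apply/matrixP => i j; rewrite !mxE scale1r. Qed.

Fact mat_scaleDr : right_distributive mat_scale +%R.
Proof. by move=> c a b; apply/matrixP => i j; rewrite !mxE scalerDr. Qed.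

Fact mat_scaleDl a : {morph mat_scale^~ a : c d / c + d}.
Proof. by move=> c d; apply/matrixP => i j; rewrite !mxE scalerDl. Qed.

HB.instance Definition _ := GRing.Zmodule_isLmodule.Build R[i] M
  mat_scaleA mat_scale1 mat_scaleDr mat_scaleDl.

Lemma matD (a b : M) i j : (a + b) i j = a i j + b i j.
Proof. by rewrite mxE. Qed.

Lemma matN (a : M) i j : (- a) i j = - a i j.
Proof. by rewrite mxE. Qed.

Lemma matZ c (a : M) i j : (c *: a) i j = c *: a i j.
Proof. by rewrite mxE. Qed.

Definition mat_norm (a : M) : R := \sum_i \sum_j nrm (a i j).

Fact mat_normD a b : (mat_norm (a + b))%:C <= (mat_norm a)%:C + (mat_norm b)%:C.
Proof.
rewrite -rmorphD lecR /mat_norm -big_split ler_sum // => i _.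
by rewrite -big_split ler_sum // => j _; rewrite matD nrmD.
Qed.

Fact mat_normZ (c : R[i]) a : (mat_norm (c *: a))%:C = `|c| * (mat_norm a)%:C.
Proof.
rewrite -Re_normE -rmorphM; congr (_%:C).
rewrite /mat_norm mulr_sumr; apply: eq_bigr => i _.
by rewrite mulr_sumr; apply: eq_bigr => j _; rewrite matZ nrmZ.
Qed.

Lemma mat_norm_entry a i j : nrm (a i j) <= mat_norm a.
Proof.
rewrite /mat_norm (bigD1 i) //= (bigD1 j) //= -addrA lerDl.
by rewrite addr_ge0 // sumr_ge0 // => k _; rewrite ?sumr_ge0 // => *;
  rewrite nrm_ge0.
Qed.

Fact mat_norm_eq0 a : (mat_norm a)%:C = 0 -> a = 0.
Proof.
move=> /complexI a0; apply/matrixP => i j; rewrite mxE.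
by apply: nrm_eq0; apply/eqP; rewrite eq_le nrm_ge0 andbT -a0 mat_norm_entry.
Qed.

HB.instance Definition _ :=
  Lmodule_isNormed.Build R[i] M mat_normD mat_normZ mat_norm_eq0.

Lemma nrm_matE (a : M) : nrm a = \sum_i \sum_j nrm (a i j).
Proof. by []. Qed.

Lemma mat_complete (F : set_system M) : ProperFilter F -> cauchy F -> cvg F.
Proof.
apply: seq_complete => u cu.
have cij i j : exists l, seq_cvg (@nrm R A) (fun k => u k i j) l.
  apply: seq_cauchy_cvg => e /cu[N hN]; exists N => k l hk hl.
  by rewrite -matN -matD (le_lt_trans (mat_norm_entry _ _ _)) // hN.
pose l : M := \matrix_(i, j) sval (cid (cij i j)).
exists l => e e0.
have d0 : 0 < e / (n * n).+1%:R by rewrite divr_gt0 // ltr0n.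
have hN i j : exists N, forall k, (N <= k)%N ->
    nrm (u k i j - l i j) < e / (n * n).+1%:R.
  have [N hN] := svalP (cid (cij i j)) _ d0.
  by exists N => k Nk; rewrite mxE; exact: hN.
pose N i j := sval (cid (hN i j)).
have NP i j k : (N i j <= k)%N -> nrm (u k i j - l i j) < e / (n * n).+1%:R.
  exact: svalP (cid (hN i j)) k.
exists (\max_i \max_j N i j) => k hk.
apply: (@le_lt_trans _ _ (\sum_(i < n) \sum_(j < n) e / (n * n).+1%:R)).
  rewrite nrm_matE ler_sum // => i _; rewrite ler_sum // => j _.
  rewrite matD matN ltW // NP //; apply: leq_trans hk.
  by apply: (leq_trans (leq_bigmax j)); exact: (leq_bigmax i).
rewrite !sumr_const !card_ord -mulrnA -[ltLHS]mulr_natr -mulrA gtr_pMr //.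
by rewrite mulrC ltr_pdivrMr ?ltr0n // mul1r ltr_nat.
Qed.

HB.instance Definition _ := Uniform_isComplete.Build M mat_complete.

Definition mat_mul (a b : M) : M :=
  \matrix_(i, j) \sum_k bmul (a i k) (b k j).

Fact mat_mulA : associative mat_mul.
Proof.
move=> a b c; apply/matrixP => i j; rewrite !mxE.
under eq_bigr do rewrite mxE bmul_sumr.
under [in RHS]eq_bigr do rewrite mxE bmul_suml.
rewrite exchange_big; apply: eq_bigr => k _; apply: eq_bigr => l _.
by rewrite bmulA.
Qed.

Fact mat_mul_linearl b : linear (mat_mul^~ b).
Proof.
move=> c a a'; apply/matrixP => i j; rewrite matD matZ !mxE scaler_sumr.
rewrite -big_split; apply: eq_bigr => k _.
by rewrite matD matZ bmul_linearl.
Qed.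

Fact mat_mul_linearr a : linear (mat_mul a).
Proof.
move=> c b b'; apply/matrixP => i j; rewrite matD matZ !mxE scaler_sumr.
rewrite -big_split; apply: eq_bigr => k _.
by rewrite matD matZ bmul_linearr.
Qed.

Fact mat_mul_norm a b : `|mat_mul a b| <= `|a| * `|b|.
Proof.
rewrite !nrmE -rmorphM lecR !nrm_matE mulr_suml ler_sum // => i _.
apply: (@le_trans _ _ (\sum_j \sum_k nrm (a i k) * nrm (b k j))).
  rewrite ler_sum // => j _; rewrite mxE (le_trans (nrm_sum _ _ _)) //.
  by rewrite ler_sum // => k _; exact: nrm_bmul.
rewrite exchange_big mulr_suml ler_sum // => k _ /=.
rewrite -mulr_sumr ler_wpM2l ?nrm_ge0 // [leRHS](bigD1 k) //= lerDl.
by rewrite sumr_ge0 // => l _; rewrite sumr_ge0 // => *; exact: nrm_ge0.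
Qed.

HB.instance Definition _ :=
  isBanachAlgebra.Build R M mat_mulA mat_mul_linearl mat_mul_linearr
    mat_mul_norm.

Lemma mat_mulE (a b : M) i j : bmul a b i j = \sum_k bmul (a i k) (b k j).
Proof. by rewrite mxE. Qed.

End MatAlg.

Section DualBimodule.
Context {R : realType} {A : banachAlgType R}.
Implicit Types (a : A) (f : dual A).

Fact dual_lact_bounded a f :
  bounded_linear (fun x : A => f (bmul x a) : cplx R).
Proof.
split=> [c x y|]; first by rewrite bmul_linearl bmap_linear.
exists (opnorm f * nrm a) => x; rewrite (le_trans (opnormP _ _)) // -mulrA.
by rewrite ler_wpM2l ?opnorm_ge0 // [leRHS]mulrC nrm_bmul.
Qed.

Definition dual_lact a f : dual A := mkbmap (dual_lact_bounded a f).

Fact dual_ract_bounded f a :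
  bounded_linear (fun x : A => f (bmul a x) : cplx R).
Proof.
split=> [c x y|]; first by rewrite bmul_linearr bmap_linear.
exists (opnorm f * nrm a) => x; rewrite (le_trans (opnormP _ _)) // -mulrA.
by rewrite ler_wpM2l ?opnorm_ge0 // nrm_bmul.
Qed.

Definition dual_ract f a : dual A := mkbmap (dual_ract_bounded f a).

Lemma dual_lactE a f x : dual_lact a f x = f (bmul x a).
Proof. by []. Qed.

Lemma dual_ractE f a x : dual_ract f a x = f (bmul a x).
Proof. by []. Qed.

Lemma dual_lact_linear a c f g :
  dual_lact a (c *: f + g) = c *: dual_lact a f + dual_lact a g.
Proof. by apply: bmap_ext => x; rewrite !(bmapDl, bmapZl, dual_lactE). Qed.

Lemma dual_ract_linear a c f g :
  dual_ract (c *: f + g) a = c *: dual_ract f a + dual_ract g a.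
Proof. by apply: bmap_ext => x; rewrite !(bmapDl, bmapZl, dual_ractE). Qed.

Definition is_derivation (D : bmap A (dual A)) : Prop :=
  forall a b, D (bmul a b) = dual_lact a (D b) + dual_ract (D a) b.

Definition is_inner (D : bmap A (dual A)) : Prop :=
  exists f : dual A, forall a, D a = dual_lact a f - dual_ract f a.

End DualBimodule.

Definition derivation_pred (R : realType) (A : banachAlgType R) :
  {pred bmap A (dual A)} := [pred D | `[< is_derivation D >]].

Section H1.
Context {R : realType}.
Variable A : banachAlgType R.

Lemma derivation_submod : submod_closed (@derivation_pred R A).
Proof.
split=> [|c D D']; rewrite !inE.
  by move=> a b; apply: bmap_ext => x; rewrite bmapDl /= addr0.
move=> hD hD' a b; rewrite bmapDl bmapZl hD hD'.
rewrite dual_lact_linear dual_ract_linear scalerDr.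
exact: addrACA.
Qed.

HB.instance Definition _ :=
  GRing.isSubmodClosed.Build R[i] (bmap A (dual A)) (@derivation_pred R A)
    derivation_submod.

Record derivation := Derivation {
  derivation_bmap :> bmap A (dual A);
  derivation_subproof : derivation_bmap \in @derivation_pred R A }.

HB.instance Definition _ := [isSub for derivation_bmap].
HB.instance Definition _ := [Choice of derivation by <:].
HB.instance Definition _ := [SubChoice_isSubLmodule of derivation by <:].

Lemma derivationP (D : derivation) : is_derivation D.
Proof. by case: D => D DP; apply/(asboolP _). Qed.

Definition mk_derivation (D : bmap A (dual A)) (h : is_derivation D) :
  derivation := Derivation (introT (asboolP _) h).

Definition inner_pred : {pred derivation} :=
  [pred D : derivation | `[< is_inner D >]].

Lemma inner_submod : submod_closed inner_pred.
Proof.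
split=> [|c D D']; rewrite !inE.
  by exists 0 => a; apply: bmap_ext => x; rewrite bmapBl /= subr0.
move=> [f hf] [f' hf']; exists (c *: f + f') => a.
rewrite dual_lact_linear dual_ract_linear.
have -> : (c *: D + D' : derivation) a = c *: D a + D' a by [].
by rewrite hf hf' scalerBr opprD addrACA.
Qed.

HB.instance Definition _ :=
  GRing.isSubmodClosed.Build R[i] derivation inner_pred inner_submod.

Definition H1 : Type := lquot inner_pred.

HB.instance Definition _ := GRing.Lmodule.on H1.

Definition H1_class (D : derivation) : H1 := lpi inner_pred D.
Definition H1_repr (h : H1) : derivation := lrepr h.

Lemma H1_reprK h : H1_class (H1_repr h) = h. Proof. exact: lreprK. Qed.

Lemma H1_class_eq D D' : H1_class D = H1_class D' <-> is_inner (D - D' : derivation).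
Proof.
apply: iff_trans (lpi_eq _ _ _) _.
by split=> /asboolP.
Qed.

End H1.

(* A bounded linear map D from the algebra to its dual is identified with the
   functional sending a (x) b to <a, D b>; an element of the dual being a map,
   <a, D b> is [D b a]. *)
Section Functional.
Context {R : realType} {A : banachAlgType R}.
Implicit Types (D : bmap A (dual A)) (phi : dual (ptensor A A)).

Fact functional_of_bounded D :
  bounded_bilinear (fun a b : A => D b a : cplx R).
Proof.
split; last first.
  exists (opnorm D) => a b; rewrite (le_trans (opnormP (D b) a)) //.
  rewrite -mulrA [nrm a * _]mulrC mulrA.
  apply: ler_wpM2r; [exact: nrm_ge0|].
  by have := opnormP D b; rewrite nrm_bmapE.
split=> [b c x y|a c x y]; first by rewrite bmap_linear.
by rewrite bmap_linear bmapDl bmapZl.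
Qed.

Definition functional_of D : dual (ptensor A A) :=
  tlift (functional_of_bounded D).

Lemma functional_ofE D a b : functional_of D (tens a b) = D b a.
Proof. exact: tliftE. Qed.

Fact map_of1_bounded phi (b : A) :
  bounded_linear (fun a : A => phi (tens a b) : cplx R).
Proof.
split=> [c x y|]; first by rewrite tens_bilinear.1 bmap_linear.
exists (opnorm phi * nrm b) => a; rewrite (le_trans (opnormP _ _)) // -mulrA.
by rewrite ler_wpM2l ?opnorm_ge0 // [leRHS]mulrC nrm_tens_le.
Qed.

Fact map_of_bounded phi :
  bounded_linear (fun b : A => mkbmap (map_of1_bounded phi b) : dual A).
Proof.
split=> [c x y|].
  apply: bmap_ext => a; rewrite bmapDl bmapZl /=.
  by rewrite tens_bilinear.2 bmap_linear.
exists (opnorm phi) => b; apply: opnorm_le.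
  by rewrite mulr_ge0 ?opnorm_ge0 ?nrm_ge0.
move=> a; rewrite /= (le_trans (opnormP _ _)) // -mulrA.
by rewrite ler_wpM2l ?opnorm_ge0 // [leRHS]mulrC nrm_tens_le.
Qed.

Definition map_of phi : bmap A (dual A) := mkbmap (map_of_bounded phi).

Lemma map_ofE phi a b : map_of phi b a = phi (tens a b).
Proof. by []. Qed.

Lemma functional_ofK D : map_of (functional_of D) = D.
Proof.
by apply: bmap_ext => b; apply: bmap_ext => a; rewrite map_ofE functional_ofE.
Qed.

Lemma functional_of_linear c D D' :
  functional_of (c *: D + D') = c *: functional_of D + functional_of D'.
Proof.
apply: ptensor_ext => a b; rewrite [RHS]bmapDl [X in _ = X + _]bmapZl.
by rewrite !functional_ofE !(bmapDl, bmapZl).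
Qed.

Lemma map_ofK phi : functional_of (map_of phi) = phi.
Proof. by apply: ptensor_ext => a b; rewrite functional_ofE. Qed.

End Functional.

Section Comp.
Context {R : realType} {E F G : normedModType R[i]}.

Fact bmap_comp_bounded (g : bmap F G) (f : bmap E F) : bounded_linear (g \o f).
Proof.
split=> [c x y|]; first by rewrite /= !bmap_linear.
exists (opnorm g * opnorm f) => x /=; rewrite (le_trans (opnormP _ _)) //.
by rewrite -mulrA ler_wpM2l ?opnorm_ge0 // opnormP.
Qed.

Definition bmap_comp g f : bmap E G := mkbmap (bmap_comp_bounded g f).

End Comp.

Definition implemented (R : realType) (A B : banachAlgType R)
    (T : bmap (ptensor A A) (ptensor B B)) (D : bmap B (dual B)) :
    bmap A (dual A) :=
  map_of (bmap_comp (functional_of D) T).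

Lemma implementedE (R : realType) (A B : banachAlgType R)
    (T : bmap (ptensor A A) (ptensor B B)) (D : bmap B (dual B)) a b :
  implemented T D b a = functional_of D (T (tens a b)).
Proof. by []. Qed.

Section H1Map.
Context {R : realType} {A B : banachAlgType R}.
Variable T : bmap (ptensor A A) (ptensor B B).
Hypothesis T_der : forall D, is_derivation D -> is_derivation (implemented T D).
Hypothesis T_inner : forall D, is_inner D -> is_inner (implemented T D).

Definition derivation_map (D : derivation B) : derivation A :=
  mk_derivation (T_der (derivationP D)).

(* [H1_mapE] below shows that the class does not depend on the chosen
   representative. *)
Definition H1_map (h : H1 B) : H1 A := H1_class (derivation_map (H1_repr h)).

Lemma implemented_linear : linear (implemented T).
Proof.
move=> c D D'; apply: bmap_ext => b; apply: bmap_ext => a.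
rewrite [RHS]bmapDl [X in _ = X + _]bmapZl !implementedE functional_of_linear.
by rewrite !(bmapDl, bmapZl).
Qed.

Lemma derivation_map_linear : linear derivation_map.
Proof. by move=> c D D'; apply/val_inj; exact: implemented_linear. Qed.

Lemma derivation_mapB D D' :
  derivation_map (D - D') = derivation_map D - derivation_map D'.
Proof.
rewrite -[- D']scaleN1r addrC derivation_map_linear.
by rewrite scaleN1r addrC.
Qed.

Lemma H1_mapE D : H1_map (H1_class D) = H1_class (derivation_map D).
Proof.
apply/H1_class_eq; rewrite -derivation_mapB; apply: T_inner.
by apply/H1_class_eq; rewrite H1_reprK.
Qed.

Lemma H1_map_linear : linear H1_map.
Proof.
move=> c h h'; rewrite -[h]H1_reprK -[h']H1_reprK.
rewrite -[H1_class (H1_repr h)]/(lpi _ _) -[H1_class (H1_repr h')]/(lpi _ _).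
rewrite -lpiZ -lpiD -/(H1_class _) -!/(H1_class _) !H1_mapE.
by rewrite derivation_map_linear /H1_class lpiD lpiZ.
Qed.

End H1Map.

Section IotaTau.
Context {R : realType}.
Variables (A : banachAlgType R) (n : nat).
Local Notation M := (matalg A n).

(* matrix indices start at 0 *)
Definition iota0 (a : A) : M :=
  \matrix_(i, j) (if (val i == 0%N) && (val j == 0%N) then a else 0).

Fact iota0_linear : linear iota0.
Proof.
move=> c a b; apply/matrixP => i j; rewrite matD matZ !mxE.
by case: ifP => _ //; rewrite scaler0 addr0.
Qed.

Fact nrm_iota0_le a : nrm (iota0 a) <= (n * n)%:R * nrm a.
Proof.
apply: (@le_trans _ _ (\sum_(i < n) \sum_(j < n) nrm a)).
  rewrite nrm_matE ler_sum // => i _; rewrite ler_sum // => j _.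
  by rewrite mxE; case: ifP => _ //; rewrite nrm0 nrm_ge0.
by rewrite !sumr_const !card_ord -mulrnA -[leLHS]mulr_natl.
Qed.

Fact iota_bounded :
  bounded_bilinear (fun a b : A => tens (iota0 a) (iota0 b)).
Proof.
split; last first.
  exists ((n * n)%:R * (n * n)%:R) => a b.
  rewrite (le_trans (nrm_tens_le _ _)) //.
  have -> : (n * n)%:R * (n * n)%:R * nrm a * nrm b =
    ((n * n)%:R * nrm a) * ((n * n)%:R * nrm b) :> R by ring.
  by rewrite ler_pM ?nrm_ge0 // nrm_iota0_le.
split=> [b c x y|a c x y]; rewrite iota0_linear.
  by rewrite tens_bilinear.1.
by rewrite tens_bilinear.2.
Qed.

Definition iota : bmap (ptensor A A) (ptensor M M) := tlift iota_bounded.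

Fact tau_bounded :
  bounded_bilinear (fun a b : M => \sum_i \sum_j tens (a i j) (b j i)).
Proof.
split; last first.
  exists 1 => a b; rewrite mul1r (le_trans (nrm_sum _ _ _)) //.
  rewrite !nrm_matE mulr_suml ler_sum // => i _.
  rewrite (le_trans (nrm_sum _ _ _)) // mulr_suml ler_sum // => j _.
  rewrite (le_trans (nrm_tens_le _ _)) // ler_wpM2l ?nrm_ge0 //.
  exact: mat_norm_entry.
split=> [b c x y|a c x y]; rewrite scaler_sumr -big_split; apply: eq_bigr => i _;
  rewrite scaler_sumr -big_split; apply: eq_bigr => j _; rewrite matD matZ.
- by rewrite tens_bilinear.1.
- by rewrite tens_bilinear.2.
Qed.

Definition tau : bmap (ptensor M M) (ptensor A A) := tlift tau_bounded.

Lemma iota_tens a b : iota (tens a b) = tens (iota0 a) (iota0 b).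
Proof. exact: tliftE. Qed.

Lemma tau_tens a b : tau (tens a b) = \sum_i \sum_j tens (a i j) (b j i).
Proof. exact: tliftE. Qed.

Lemma implemented_iotaE (D : bmap M (dual M)) a b :
  implemented iota D b a = D (iota0 b) (iota0 a).
Proof. by rewrite implementedE iota_tens functional_ofE. Qed.

Lemma implemented_tauE (D : bmap A (dual A)) (a b : M) :
  implemented tau D b a = \sum_i \sum_j D (b j i) (a i j).
Proof.
rewrite implementedE tau_tens bmap_sumr; apply: eq_bigr => i _.
by rewrite bmap_sumr; apply: eq_bigr => j _; rewrite functional_ofE.
Qed.

Lemma iota0M a b : iota0 (bmul a b) = bmul (iota0 a) (iota0 b).
Proof.
apply/matrixP => i j; rewrite mat_mulE mxE.
have [i0|i0] /= := boolP (val i == 0%N); last first.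
  rewrite big1 // => k _; rewrite !mxE (negPf i0) /=.
  by rewrite bmul0l.
rewrite (bigD1 i) //= !mxE i0 /= big1 ?addr0 => [|k ki].
  by case: ifP => //; rewrite bmul0r.
rewrite !mxE i0 /= ifF ?bmul0l //; apply/negP => /eqP k0.
by move/eqP: ki; apply; apply/val_inj; move/eqP: i0 => /= ->.
Qed.

Lemma iota_derivation D : is_derivation D -> is_derivation (implemented iota D).
Proof.
move=> hD a b; apply: bmap_ext => x.
rewrite [RHS]bmapDl dual_lactE dual_ractE !implemented_iotaE !iota0M hD.
by rewrite bmapDl dual_lactE dual_ractE.
Qed.

Lemma iota_inner D : is_inner D -> is_inner (implemented iota D).
Proof.
move=> [f hf].
have fb : bounded_linear (fun a : A => f (iota0 a) : cplx R).
  split=> [c x y|]; first by rewrite iota0_linear bmap_linear.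
  exists (opnorm f * (n * n)%:R) => a; rewrite (le_trans (opnormP _ _)) //.
  by rewrite -mulrA ler_wpM2l ?opnorm_ge0 // nrm_iota0_le.
exists (mkbmap fb) => b; apply: bmap_ext => a.
rewrite implemented_iotaE hf !bmapBl !dual_lactE !dual_ractE.
by rewrite -!iota0M.
Qed.

Lemma tau_derivation D : is_derivation D -> is_derivation (implemented tau D).
Proof.
move=> hD b c; apply: bmap_ext => a.
rewrite bmapDl dual_lactE dual_ractE !implemented_tauE.
transitivity (\sum_i \sum_j \sum_k
    (D (c k i) (bmul (a i j) (b j k)) + D (b j k) (bmul (c k i) (a i j)))).
  apply: eq_bigr => i _; apply: eq_bigr => j _.
  rewrite mat_mulE bmap_sumr bmap_suml; apply: eq_bigr => k _.
  by rewrite hD bmapDl dual_lactE dual_ractE.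
under eq_bigr do under eq_bigr do rewrite big_split.
under eq_bigr do rewrite big_split.
rewrite big_split; congr (_ + _).
  apply: eq_bigr => i _; rewrite exchange_big; apply: eq_bigr => k _.
  by rewrite mat_mulE bmap_sumr.
under eq_bigr do rewrite exchange_big.
rewrite exchange_big; apply: eq_bigr => k _.
rewrite exchange_big; apply: eq_bigr => j _.
by rewrite mat_mulE bmap_sumr.
Qed.

Lemma sum_sumB (V : zmodType) (F G : 'I_n -> 'I_n -> V) :
  \sum_i \sum_j (F i j - G i j) =
  \sum_i \sum_j F i j - \sum_i \sum_j G i j.
Proof. by rewrite -sumrB; apply: eq_bigr => i _; rewrite sumrB. Qed.

Lemma tau_inner D : is_inner D -> is_inner (implemented tau D).
Proof.
move=> [f hf].
have fb : bounded_linear (fun a : M => \sum_i f (a i i) : cplx R).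
  split=> [c x y|].
    rewrite scaler_sumr -big_split; apply: eq_bigr => i _.
    by rewrite matD matZ bmap_linear.
  exists (opnorm f) => a; rewrite (le_trans (nrm_sum _ _ _)) //.
  rewrite nrm_matE mulr_sumr ler_sum // => i _.
  rewrite (le_trans (opnormP _ _)) // ler_wpM2l ?opnorm_ge0 //.
  by rewrite (bigD1 i) //= lerDl sumr_ge0 // => j _; exact: nrm_ge0.
exists (mkbmap fb) => b; apply: bmap_ext => a.
rewrite implemented_tauE bmapBl dual_lactE dual_ractE /=.
apply: etrans.
  apply: eq_bigr => i _; apply: eq_bigr => j _.
  by rewrite hf bmapBl dual_lactE dual_ractE.
apply: etrans (sum_sumB _ _) _; congr (_ - _).
  by apply: eq_bigr => i _; rewrite mat_mulE bmap_sumr.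
rewrite exchange_big; apply: eq_bigr => j _.
by rewrite mat_mulE bmap_sumr.
Qed.

Definition iota_star : H1 M -> H1 A := H1_map iota_derivation.

Definition tau_star : H1 A -> H1 M := H1_map tau_derivation.

Lemma iota_starE D :
  iota_star (H1_class D) = H1_class (derivation_map iota_derivation D).
Proof. exact: (H1_mapE iota_derivation iota_inner). Qed.

Lemma tau_starE D :
  tau_star (H1_class D) = H1_class (derivation_map tau_derivation D).
Proof. exact: (H1_mapE tau_derivation tau_inner). Qed.

Lemma iota_star_linear : linear iota_star.
Proof. exact: (H1_map_linear iota_derivation iota_inner). Qed.

Lemma tau_star_linear : linear tau_star.
Proof. exact: (H1_map_linear tau_derivation tau_inner). Qed.

End IotaTau.

Arguments iota_star {R} A n _.
Arguments tau_star {R} A n _.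

(* Main.v *)
(** Since [iota^* o tau^*] is the identity already on derivations, only
    [tau^* o iota^*] needs an argument. Write [psi(X, Y) = <X, D Y>] and
    [e_ij(a)] for the matrix with the single entry [a]; the index 0 below is the
    paper's index 1. When [A] is unital, [tau^* iota^* D - D] is implemented by
    [f(e_ij(c)) = psi(e_0j(c), e_i0(1))]. Without a unit,
    [(a, c) |-> psi(e_0j(c), e_i0(a))] is not balanced when [i = j], but its
    defect is that of [psi(e_00(c), e_00(a))]; the difference is balanced, so it
    factors through multiplication because [A] is self-induced, and these
    factorisations are the entries of [f]. To check that [f] works one may take
    the entry of [Y] to be a product, and the remaining identity holds because
    [psi(U, V) + psi(V, U)] is balanced for every cocycle [psi]. *)
Require Import Defs.
From mathcomp Require Import all_boot all_order all_algebra complex reals.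
From mathcomp Require Import boolp normedtype.
Set Implicit Arguments.
Unset Strict Implicit.
Unset Printing Implicit Defensive.
Import Order.TTheory GRing.Theory Num.Theory.
Local Open Scope ring_scope.
Local Open Scope complex_scope.

Local Arguments bmap_fun : simpl never.

Lemma bmap_compE (R : realType) (E F G : normedModType R[i])
  (g : bmap F G) (f : bmap E F) x : bmap_comp g f x = g (f x).
Proof. by []. Qed.

(** * Bounded maps on a self-induced algebra *)

Section SelfInducedTheory.
Context {R : realType} {A : banachAlgType R}.
Hypothesis hA : self_induced A.

Lemma ptensor_mulE (a b : A) : ptensor_mul A (tens a b) = bmul a b.
Proof. exact: tliftE. Qed.

(** The quotient map and [btensor_mul] are onto, so [f] and [g] are determined by their pullbacks to
    the projective tensor product, where elementary tensors suffice. *)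
Lemma self_induced_ext (G : normedModType R[i]) (f g : bmap A G) :
  (forall a b, f (bmul a b) = g (bmul a b)) -> f = g.
Proof.
move=> fg; have fg' : bmap_comp f (ptensor_mul A) = bmap_comp g (ptensor_mul A).
  by apply: ptensor_ext => a b; rewrite !bmap_compE ptensor_mulE fg.
have [h [_ hK]] := hA; apply: bmap_ext => x.
rewrite -[x]hK -[h x]nreprK [btensor_mul A _]nquot_liftE.
by rewrite -!bmap_compE fg'.
Qed.

(** Balance lets [phi] descend to [btensor]; the inverse of [btensor_mul] then carries it to [A].
    With a unit, [F x] would be [phi (tens x 1)]. *)
Lemma self_induced_factor (G : normedModType R[i]) (phi : bmap (ptensor A A) G) :
  (forall a b c, phi (tens (bmul a b) c) = phi (tens a (bmul b c))) ->
  exists F : bmap A G, forall a b, F (bmul a b) = phi (tens a b).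
Proof.
move=> bal; have [h [hK _]] := hA.
have phi0 t : balanced_relations t -> phi t = 0.
  by move=> [a [b [c ->]]]; rewrite bmapBr bal subrr.
exists (bmap_comp (nquot_lift phi0) h) => a b.
have -> : bmul a b = btensor_mul A (npi _ (tens a b)).
  by rewrite nquot_liftE ptensor_mulE.
by rewrite bmap_compE hK nquot_liftE.
Qed.

End SelfInducedTheory.

Lemma bounded_bilinear_comp (R : realType) (E F M G : normedModType R[i])
    (D : bmap M (bmap M G)) (u : bmap E M) (v : bmap F M) :
  bounded_bilinear (fun x y => D (u x) (v y)).
Proof.
split.
  by split=> [y c x x'|x c y y']; rewrite !bmap_linear ?bmapDl ?bmapZl.
exists (opnorm D * opnorm u * opnorm v) => x y.
rewrite (le_trans (opnormP _ _)) //.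
have -> : opnorm D * opnorm u * opnorm v * nrm x * nrm y =
  (opnorm D * (opnorm u * nrm x)) * (opnorm v * nrm y).
  by rewrite !mulrA; congr (_ * _); rewrite -!mulrA; congr (_ * (_ * _)); rewrite mulrC.
rewrite ler_pM ?opnorm_ge0 ?nrm_ge0 ?opnormP // -nrm_bmapE.
by rewrite (le_trans (opnormP _ _)) // ler_wpM2l ?opnorm_ge0 ?opnormP.
Qed.

(** * Matrix units and maps given entrywise *)

Section MatrixUnits.
Context {R : realType} {A : banachAlgType R} {n : nat}.
Local Notation M := (matalg A n).

Definition mat_single_fun (i j : 'I_n) (a : A) : M :=
  \matrix_(k, l) (if (k == i) && (l == j) then a else 0).

Fact mat_single_bounded i j : bounded_linear (mat_single_fun i j).
Proof.
split=> [c x y|].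
  apply/matrixP => k l; rewrite matD matZ !mxE.
  by case: ifP => _ //; rewrite scaler0 addr0.
exists 1 => a; rewrite mul1r nrm_matE (bigD1 i) //= [X in _ + X]big1 => [|k ki].
  rewrite (bigD1 j) //= [X in _ + X + _]big1 => [|l lj].
    by rewrite mxE !eqxx !addr0.
  by rewrite mxE (negPf lj) andbF nrm0.
by apply: big1 => l _; rewrite mxE (negPf ki) nrm0.
Qed.

Definition mat_single i j : bmap A M := mkbmap (mat_single_bounded i j).

Lemma mat_singleE i j a k l :
  mat_single i j a k l = if (k == i) && (l == j) then a else 0.
Proof. by rewrite mxE. Qed.

Lemma mat_single_sum (X : M) : X = \sum_i \sum_j mat_single i j (X i j).
Proof.
apply/matrixP => k l; rewrite summxE (bigD1 k) //= [X in _ + X]big1 => [|i ik].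
  rewrite addr0 summxE (bigD1 l) //= [X in _ + X]big1 => [|j jl].
    by rewrite mat_singleE !eqxx addr0.
  by rewrite mat_singleE eqxx eq_sym (negPf jl).
by rewrite summxE big1 // => j _; rewrite mat_singleE eq_sym (negPf ik).
Qed.

Lemma mat_singleM i j k l a b :
  bmul (mat_single i j a) (mat_single k l b) =
  if j == k then mat_single i l (bmul a b) else 0.
Proof.
apply/matrixP => p q; rewrite mat_mulE (bigD1 j) //= big1 => [|r rj]; last first.
  by rewrite mat_singleE (negPf rj) andbF bmul0l.
rewrite addr0 !mat_singleE eqxx andbT.
case: (j == k); rewrite ?mat_singleE /=.
  by case: (p == i); case: (q == l) => //=; rewrite ?bmul0l ?bmul0r.
by rewrite bmul0r mxE.
Qed.

Fact mat_entry_bounded i j : bounded_linear (fun X : M => X i j).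
Proof.
split=> [c x y|]; first by rewrite matD matZ.
by exists 1 => a; rewrite mul1r mat_norm_entry.
Qed.

Definition mat_entry i j : bmap M A := mkbmap (mat_entry_bounded i j).

Lemma mat_entryE i j (X : M) : mat_entry i j X = X i j.
Proof. by []. Qed.

Lemma mat_bmap_ext (G : normedModType R[i]) (f g : bmap M G) :
  (forall i j a, f (mat_single i j a) = g (mat_single i j a)) -> f = g.
Proof.
move=> fg; apply: bmap_ext => X; rewrite [X]mat_single_sum !bmap_sumr.
apply: eq_bigr => i _; rewrite !bmap_sumr; apply: eq_bigr => j _; exact: fg.
Qed.

(** Summing over the finitely many entry projections preserves boundedness; this assembles
    functionals chosen separately for each entry. *)
Lemma mat_glue (G : normedModType R[i]) (F : 'I_n -> 'I_n -> bmap A G) :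
  exists f : bmap M G, forall i j a, f (mat_single i j a) = F i j a.
Proof.
exists (\sum_i \sum_j bmap_comp (F i j) (mat_entry i j)) => i j a.
rewrite bmap_suml (bigD1 i) //= [X in _ + X]big1 => [|k ki].
  rewrite addr0 bmap_suml (bigD1 j) //= [X in _ + X]big1 => [|l lj].
    by rewrite addr0 bmap_compE mat_entryE mat_singleE !eqxx.
  by rewrite bmap_compE mat_entryE mat_singleE eqxx (negPf lj) bmap0r.
rewrite bmap_suml big1 // => l _.
by rewrite bmap_compE mat_entryE mat_singleE (negPf ki) bmap0r.
Qed.

End MatrixUnits.

(** * Cocycle identities and inner derivations *)

Section Cocycle.
Context {R : realType} {B : banachAlgType R}.
Variable D : bmap B (dual B).
Hypothesis hD : is_derivation D.

Lemma derivationE x y z : D (bmul y z) x = D z (bmul x y) + D y (bmul z x).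
Proof. by rewrite hD bmapDl dual_lactE dual_ractE. Qed.

(** Expanding [D] at each product by [derivationE] gives the same three terms on both sides. *)
Lemma cocycle_sym_balanced x y z :
  D (bmul y z) x + D x (bmul y z) = D z (bmul x y) + D (bmul x y) z.
Proof. by rewrite !derivationE addrA. Qed.

End Cocycle.

(** Packages an inner derivation as a bounded map, so that extensionality for bounded maps applies
    to it. *)
Fact inner_bounded (R : realType) (B : banachAlgType R) (f : dual B) :
  bounded_linear (fun a : B => dual_lact a f - dual_ract f a).
Proof.
split=> [c a b|].
  apply: bmap_ext => x.
  rewrite !(bmapDl, bmapNl, bmapZl, dual_lactE, dual_ractE).
  by rewrite bmul_linearr bmul_linearl !bmap_linear scalerBr opprD addrACA.
exists (opnorm f + opnorm f) => a; apply: opnorm_le => [|x].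
  by rewrite mulr_ge0 ?addr_ge0 ?opnorm_ge0 ?nrm_ge0.
rewrite bmapBl dual_lactE dual_ractE (le_trans (nrmD _ _)) // nrmN.
rewrite -mulrA mulrDl lerD // (le_trans (opnormP _ _)) //;
  rewrite ler_wpM2l ?opnorm_ge0 // (le_trans (nrm_bmul _ _)) //.
by rewrite mulrC.
Qed.

(** * The composite of [iota] and [tau] on derivations *)

Section TauIota.
Context {R : realType} {A : banachAlgType R} {n : nat}.
Hypothesis hA : self_induced A.
Local Notation M := (matalg A n.+1).
Local Notation eps := (@mat_single R A n.+1).
Local Notation o := (@ord0 n).

Lemma iota0_mat_single (a : A) : iota0 n.+1 a = eps o o a.
Proof. by apply/matrixP => i j; rewrite !mxE. Qed.

Lemma implemented_tau_iota (D : bmap M (dual M)) i j k l x y :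
  implemented (tau A n.+1) (implemented (Defs.iota A n.+1) D)
    (eps k l y) (eps i j x) =
  if (j == k) && (l == i) then D (eps o o y) (eps o o x) else 0.
Proof.
rewrite implemented_tauE (bigD1 i) //= [X in _ + X]big1 => [|p pi]; last first.
  rewrite big1 // => q _; rewrite implemented_iotaE [eps i j x _ _]mat_singleE.
  by rewrite (negPf pi) !iota0_mat_single !bmap0r.
rewrite addr0 (bigD1 j) //= [X in _ + X]big1 => [|q qj]; last first.
  rewrite implemented_iotaE [eps i j x _ _]mat_singleE.
  by rewrite (negPf qj) andbF !iota0_mat_single !bmap0r.
rewrite addr0 implemented_iotaE !iota0_mat_single !mat_singleE !eqxx.
by rewrite [l == i]eq_sym; case: ifP => // _; rewrite !bmap0r.
Qed.

Section Derivation.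
Variable D : bmap M (dual M).
Hypothesis hD : is_derivation D.

(* [F] is entry [(i, j)] of the functional implementing [tau^* iota^* D - D]. *)
Lemma cocycle_potential i j : exists F : dual A, forall a c,
  F (bmul a c) = D (eps i o a) (eps o j c)
    - (if i == j then D (eps o o a) (eps o o c) else 0).
Proof.
pose phi := tlift (bounded_bilinear_comp D (eps i o) (eps o j)).
pose theta := tlift (bounded_bilinear_comp D (eps o o) (eps o o)).
pose chi : dual (ptensor A A) := phi - (if i == j then theta else 0).
have chiE a c : chi (tens a c) = D (eps i o a) (eps o j c)
    - (if i == j then D (eps o o a) (eps o o c) else 0).
  by rewrite [LHS]bmapBl tliftE; case: ifP => _ //; rewrite tliftE.
have [a b c|F FE] := self_induced_factor hA (phi := chi).
  rewrite !chiE.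
  (* Moving [b] across costs [D (eps o o b) (eps o o (bmul c a))] if [i = j] and nothing otherwise;
     [theta] has this same defect, so it cancels. *)
  have := derivationE hD (eps o j c) (eps i o a) (eps o o b).
  have := derivationE hD (eps o o c) (eps o o a) (eps o o b).
  rewrite !mat_singleM !eqxx eq_sym => -> ->.
  case: ifP => _; last by rewrite !bmap0r add0r.
  by rewrite opprD addrACA subrr add0r.
by exists F => a c; rewrite FE chiE.
Qed.

Lemma tau_iota_inner :
  is_inner (implemented (tau A n.+1) (implemented (Defs.iota A n.+1) D) - D).
Proof.
have [f fE] := mat_glue (fun i j => sval (cid (cocycle_potential i j))).
have {}fE i j a c : f (eps i j (bmul a c)) = D (eps i o a) (eps o j c)
    - (if i == j then D (eps o o a) (eps o o c) else 0).
  by rewrite fE; exact: (svalP (cid (cocycle_potential i j))).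
exists f; set E := _ - D; pose I : bmap M (dual M) := mkbmap (inner_bounded f).
suff -> : E = I by [].
apply: mat_bmap_ext => k l t.
suff : bmap_comp E (eps k l) = bmap_comp I (eps k l).
  by move/(congr1 (fun u : bmap A (dual M) => u t)).
apply: (self_induced_ext hA) => y z.
apply: mat_bmap_ext => i j x.
rewrite !bmap_compE [LHS]bmapBl implemented_tau_iota.
rewrite [X in _ = bmap_fun X _]/(dual_lact _ f - dual_ract f _).
rewrite [RHS]bmapBl dual_lactE dual_ractE !mat_singleM.
(* The matrix splits as [eps k o y] times [eps o l z]; the middle index is 0 to match the formula
   for [f]. *)
have Dkl : D (eps k l (bmul y z)) (eps i j x) =
    D (eps o l z) (if j == k then eps i o (bmul x y) else 0) +
    D (eps k o y) (if l == i then eps o j (bmul z x) else 0).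
  have := derivationE hD (eps i j x) (eps k o y) (eps o l z).
  by rewrite !mat_singleM eqxx.
have Doo : D (eps o o (bmul y z)) (eps o o x) =
    D (eps o o z) (eps o o (bmul x y)) + D (eps o o y) (eps o o (bmul z x)).
  have := derivationE hD (eps o o x) (eps o o y) (eps o o z).
  by rewrite !mat_singleM eqxx.
(* Shifting [eps i o x] to the other argument of the symmetrised form multiplies it by [eps o l z],
   which gives 0 unless [l = i]. *)
have sym : D (eps i o (bmul x y)) (eps o l z) + D (eps o l z) (eps i o (bmul x y))
    = if l == i then D (eps o o y) (eps o o (bmul z x)) +
                     D (eps o o (bmul z x)) (eps o o y) else 0.
  have := cocycle_sym_balanced hD (eps o l z) (eps i o x) (eps o o y).
  rewrite !mat_singleM eqxx => ->.
  by case: ifP; rewrite ?bmap0r ?bmap0l ?addr0.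
have symoo : D (eps o o (bmul x y)) (eps o o z) + D (eps o o z) (eps o o (bmul x y))
    = D (eps o o y) (eps o o (bmul z x)) + D (eps o o (bmul z x)) (eps o o y).
  have := cocycle_sym_balanced hD (eps o o z) (eps o o x) (eps o o y).
  by rewrite !mat_singleM eqxx.
rewrite Dkl Doo bmulA -[bmul (bmul y z) x]bmulA.
(* The terms pairing [y] with [bmul z x] cancel directly. For [j = k] the rest is [sym], combined
   with [symoo] when [l = i]; for [j != k] nothing is left. *)
have [jk|jk] /= := eqVneq j k; have [li|li] := eqVneq l i; subst;
  rewrite ?fE ?eqxx ?bmap0r.
- move: sym; rewrite eqxx -symoo => sym.
  rewrite opprD opprB addrACA; congr (_ + _).
  apply/eqP; rewrite subr_eq addrAC eq_sym subr_eq sym.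
  by rewrite addrC.
- move: sym; rewrite (negPf li) eq_sym (negPf li) !subr0 addr0 sub0r.
  by move/eqP; rewrite addr_eq0 => /eqP ->.
- by rewrite [k == j]eq_sym (negPf jk) subr0 !add0r.
- by rewrite addr0.
Qed.

End Derivation.
End TauIota.

Theorem theorem2p7 (R : realType) (A : banachAlgType R) (n : nat)
  (hn : (1 <= n)%N) (hA : self_induced A) :
  cancel (iota_star A n) (tau_star A n) /\
  cancel (tau_star A n) (iota_star A n).
Proof.
(* A positive size provides the index [ord0]. *)
case: n hn => // n _; split=> h; rewrite -[h]H1_reprK.
  rewrite iota_starE tau_starE; apply/H1_class_eq.
  exact: (tau_iota_inner hA (derivationP (H1_repr h))).
(* The derivations themselves agree: in the sum for [tau] only the entry [(0, 0)] contributes. *)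
rewrite tau_starE iota_starE; congr H1_class; apply: val_inj.
apply: bmap_ext => b; apply: bmap_ext => a.
rewrite /= implemented_iotaE !iota0_mat_single implemented_tauE.
rewrite (bigD1 ord0) //= [X in _ + X]big1 => [|p p0]; last first.
  by apply: big1 => q _; rewrite !mat_singleE (negPf p0) andbF !bmap0r.
rewrite addr0 (bigD1 ord0) //= [X in _ + X]big1 => [|q q0]; last first.
  by rewrite !mat_singleE (negPf q0) andbF !bmap0r.
by rewrite addr0 !mat_singleE.
Qed.
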